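(* Let $\alpha>0$ and let $(X,d,\mu)$ be a complete $\alpha$-Ahlfors regular space whose $d$-balls are open sets. Let $k\ge 1$ be an integer. Let $\varphi:\mathbb{R}_{\geq 0}\to\mathbb{R}_{\geq 0}$ be a nonincreasing function such that $0<s(\varphi)=\int_0^\infty\varphi(t)t^{k\alpha-1}\,dt<\infty$. Let $1<p_j\le\infty$, $j=1,\ldots,k$, satisfy $\sum_{j=1}^k\frac{1}{p_j}=1$ (with $1/\infty=0$). Then for all $f_j\in L^{p_j}(X,\mu)$, $j=1,\ldots,k$, $$\lim_{\varepsilon\to 0^+}\int_{X^k}\Phi_\varepsilon(x,x_1,\ldots,x_k)\left|\prod_{j=1}^k f_j(x_j)-\prod_{j=1}^k f_j(x)\right|d\mu^k(x_1,\ldots,x_k)=0$$ for almost every $x\in X$.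
   Context: A quasi-metric on a set $X$ is a symmetric function $d:X\times X\to\mathbb{R}_{\ge0}$ with $d(x,y)=0$ if and only if $x=y$, for which there is a constant $\kappa\ge1$ with $d(x,z)\le\kappa(d(x,y)+d(y,z))$ for all $x,y,z\in X$. Balls are $B_d(x,r)=\{y\in X:d(x,y)<r\}$, $r>0$. The topology on $X$ is the one induced by $d$ (a set is open if it contains a ball centered at each of its points). Complete means that every $d$-Cauchy sequence converges. $\mu$ is a positive measure on a $\sigma$-algebra containing the $d$-balls, and $\mu^k$ is the product measure on $X^k$. $(X,d,\mu)$ is $\alpha$-Ahlfors regular if there are constants $0<\gamma\le\Gamma<\infty$ with $\gamma r^\alpha\le\mu(B_d(x,r))\le\Gamma r^\alpha$ for every $x\in X$ and every $r>0$. The hypermetric of order $k+1$ on $X$ induced by $d$ is $\rho:X^{k+1}\to\mathbb{R}_{\ge0}$, $\rho(x_0,x_1,\ldots,x_k)=\inf_{u\in X}\max_{0\le i\le k}d(x_i,u)$, i.e. the distance from $(x_0,\ldots,x_k)$ to the diagonal of $X^{k+1}$ for the quasi-metric $d^{k+1}(\boldsymbol{x},\boldsymbol{y})=\max_{0\le i\le k} d(x_i,y_i)$. For $\varepsilon>0$, $x\in X$ and $(x_1,\ldots,x_k)\in X^k$, $$\Phi_\varepsilon(x,x_1,\ldots,x_k)=\frac{1}{J(x,\varepsilon)}\varphi\left(\frac{\rho(x,x_1,\ldots,x_k)}{\varepsilon}\right),\qquad J(x,\varepsilon)=\int_{X^k}\varphi\left(\frac{\rho(x,x_1,\ldots,x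_k)}{\varepsilon}\right)d\mu^k(x_1,\ldots,x_k).$$
   Formalization: The measure is also assumed Borel regular: every measurable set lies in a set of equal measure from the σ-algebra generated by the balls; with an arbitrary larger σ-algebra (e.g. Lebesgue measure extended to a Bernstein set) the claim fails. *)

(* Defs.v *)
From HB Require Import structures.
From mathcomp Require Import all_boot all_order all_algebra.
From mathcomp Require Import all_classical all_reals all_analysis.

Set Implicit Arguments.
Unset Strict Implicit.
Unset Printing Implicit Defensive.

Import Order.TTheory GRing.Theory Num.Theory.
Import numFieldNormedType.Exports.

Local Open Scope classical_set_scope.
Local Open Scope ring_scope.

Section quasi_metric.
Context {R : realType} {X : Type} (d : X -> X -> R).

Definition quasi_metric : Prop :=
  [/\ forall x y, 0 <= d x y,
      forall x y, d x y = d y x,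
      forall x y, d x y = 0 <-> x = y &
      exists2 kappa : R, 1 <= kappa &
        forall x y z, d x z <= kappa * (d x y + d y z)].

Definition qball (x : X) (r : R) : set X := [set y | d x y < r].

Definition qopen (U : set X) : Prop :=
  forall x, U x -> exists2 r : R, 0 < r & qball x r `<=` U.

Definition qcauchy (u : nat -> X) : Prop :=
  forall e : R, 0 < e ->
    exists N, forall m n, (N <= m)%N -> (N <= n)%N -> d (u m) (u n) < e.

Definition qconverges (u : nat -> X) (x : X) : Prop :=
  forall e : R, 0 < e -> exists N, forall n, (N <= n)%N -> d (u n) x < e.

Definition qcomplete : Prop :=
  forall u, qcauchy u -> exists x, qconverges u x.

Definition qball_sigma_algebra : set (set X) :=
  <<s [set A | exists x r, 0 < r /\ A = qball x r] >>.

(* As [d] is nonnegative, the value 0 for the empty maximum is harmless. *)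
Definition hypermetric n (x : n.+1.-tuple X) : R :=
  inf [set \big[Num.max/0]_(i < n.+1) d (tnth x i) u | u in [set: X]].

End quasi_metric.

Section measures.
Context {R : realType} {disp : measure_display} {X : measurableType disp}.
Variable mu : {measure set X -> \bar R}.

(* In a separable space with open balls, the balls generate the Borel
   sigma-algebra; an Ahlfors regular space is separable.  The condition is
   not automatic, since [X] may carry a larger sigma-algebra: on the real
   line, adjoin a set [A] such that neither [A] nor its complement contains an
   uncountable Borel set, and extend Lebesgue measure by giving [B `&` A]
   half the measure of [B].  Then [\1_A] has average 1/2 on every ball, so
   Lebesgue differentiation fails at every point. *)
Definition borel_regular (d : X -> X -> R) : Prop :=
  forall A, measurable A ->
    exists B, [/\ qball_sigma_algebra d B, A `<=` B & mu B = mu A].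

Definition ahlfors_regular (d : X -> X -> R) (alpha : R) : Prop :=
  exists gamma Gamma : R, [/\ 0 < gamma, gamma <= Gamma &
    forall x r, 0 < r ->
      ((gamma * r `^ alpha)%:E <= mu (qball d x r) <= (Gamma * r `^ alpha)%:E)%E].

(* Iterated binary product, transported to the measurable space of [k]-tuples;
   for sigma-finite [mu], this is the product measure (see [power_measureX]). *)
Fixpoint power_measure (k : nat) : set (k.-tuple X) -> \bar R :=
  if k is k'.+1 return set (k.-tuple X) -> \bar R then
    pushforward (mu \x @power_measure k')%E
      (fun z : X * k'.-tuple X => [tuple of z.1 :: z.2])
  else \d_[tuple].

End measures.

Arguments power_measure {R disp X} mu k _.

Section kernel.
Context {R : realType} {disp : measure_display} {X : measurableType disp}.
Variables (d : X -> X -> R) (mu : {measure set X -> \bar R}) (k : nat).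
Variable phi : R -> R.

Definition hyper_profile (eps : R) (x : X) (y : k.-tuple X) : R :=
  phi (hypermetric d [tuple of x :: y] / eps).

Definition hyper_mass (eps : R) (x : X) : \bar R :=
  (\int[power_measure mu k]_y (hyper_profile eps x y)%:E)%E.

Definition hyper_kernel (eps : R) (x : X) (y : k.-tuple X) : \bar R :=
  ((hyper_mass eps x)^-1 * (hyper_profile eps x y)%:E)%E.

End kernel.

Section bundle_sigma_finite.
Context {R : realType} {disp : measure_display} {T : measurableType disp}.
Variables (mu : {measure set T -> \bar R}) (sf : sigma_finite setT mu).

Let nu : set T -> \bar R := mu.

HB.instance Definition _ := Measure.on nu.
HB.instance Definition _ := Measure_isSigmaFinite.Build _ _ _ nu sf.

Lemma bundle_sigma_finite :
  exists m : {sigma_finite_measure set T -> \bar R}, mu = m :> (set T -> \bar R).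
Proof. by exists nu. Qed.

End bundle_sigma_finite.

Section power_measure_theory.
Context {R : realType} {disp : measure_display} {X : measurableType disp}.
Variable mu : {sigma_finite_measure set X -> \bar R}.

Lemma power_measure_sigma_finite k :
  exists m : {sigma_finite_measure set (k.-tuple X) -> \bar R},
    power_measure mu k = m.
Proof.
elim: k => [|k [m IH]]; first by exists (\d_[tuple]).
pose c (z : X * k.-tuple X) : k.+1.-tuple X := [tuple of z.1 :: z.2].
have mc : measurable_fun [set: X * k.-tuple X] c.
  by apply: measurable_cons; [exact: measurable_fst|exact: measurable_snd].
pose c' (y : k.+1.-tuple X) := (tnth y ord0, [tuple of behead y]).
have mc' : measurable_fun [set: k.+1.-tuple X] c'.
  apply/measurable_fun_pairP; split; first exact: measurable_tnth.
  exact: measurable_behead.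
have cK : cancel c c'.
  by case=> x y; congr pair; exact: val_inj.
have c'K : cancel c' c.
  by move=> y; rewrite /c /c' /= -tuple_eta.
have [m1 m1E] : exists m1 : {measure set (k.+1.-tuple X) -> \bar R},
    pushforward (mu \x m)%E c = m1.
  by exists (measure_function_pushforward__canonical__measure_function_Measure
    (mu \x m)%E mc).
have sf : sigma_finite setT m1.
  have /sigma_finiteP[F [FT ndF Foo]] := sigma_finiteT mu.
  have /sigma_finiteP[G [GT ndG Goo]] := sigma_finiteT m.
  exists (fun i => c' @^-1` (F i `*` G i)).
    apply/seteqP; split => // y _ /=.
    have : [set: X] (c' y).1 by [].
    rewrite FT => -[i _ Fi].
    have : [set: k.-tuple X] (c' y).2 by [].
    rewrite GT => -[j _ Gj].
    exists (maxn i j) => //; split.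
      by move: Fi; exact/subsetPset/ndF/leq_maxl.
    by move: Gj; exact/subsetPset/ndG/leq_maxr.
  move=> i; have [mF Fi] := Foo i; have [mG Gi] := Goo i; split.
    by rewrite -[X in measurable X]setTI; apply: mc' => //; exact: measurableX.
  rewrite -m1E /pushforward -comp_preimage (_ : c' \o c = id); last first.
    by apply/funext => z /=; rewrite cK.
  by rewrite preimage_id product_measure1E// lte_mul_pinfty// ge0_fin_numE.
have [m2 m2E] := bundle_sigma_finite sf.
by exists m2; rewrite /= IH m1E m2E.
Qed.

Lemma power_measureX k (A : 'I_k -> set X) : (forall i, measurable (A i)) ->
  power_measure mu k [set y : k.-tuple X | forall i, A i (tnth y i)] =
  (\prod_(i < k) mu (A i))%E.
Proof.
elim: k A => [|k IH] A mA.
  by rewrite big_ord0 /= diracE mem_set// => -[].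
have [m mE] := power_measure_sigma_finite k.
rewrite /= /pushforward.
rewrite [X in (_ \x _)%E X](_ : _ =
  A ord0 `*` [set y : k.-tuple X | forall i, A (lift ord0 i) (tnth y i)]).
  rewrite mE product_measure1E//.
    by rewrite big_ord_recl -IH// mE.
  rewrite [X in measurable X](_ : _ =
    \bigcap_i ((fun y : k.-tuple X => tnth y i) @^-1` A (lift ord0 i))).
    apply: fin_bigcap_measurable => // i _.
    by rewrite -[X in measurable X]setTI; exact: measurable_tnth.
  by apply/seteqP; split => y /= H i; [move=> _|]; exact: H.
apply/seteqP; split => -[x y] /=.
  move=> H; split; first exact: (H ord0).
  by move=> i; have := H (lift ord0 i); rewrite tnthS.
move=> [Ax Ay] i; have [j ->|->//] := unliftP ord0 i.
by rewrite tnthS.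
Qed.

End power_measure_theory.

(* Main.v *)
(* By [max_i d(x,x_i) / (2 kappa) <= rho(x,x_1,..,x_k) <= max_i d(x,x_i)] and the
   monotonicity of [phi], the mass [J(x,eps)] is at least a constant times
   [eps^(k alpha)], and [phi(rho/eps)] is at most the sum over [n >= 0] of
   [phi(2^(n-1))] (of [phi(0)] if [n = 0]) times the indicator of the cube
   [B(x, 2 kappa eps 2^n)^k].  So the integral is at most
   [sum_n w_n A(2 kappa eps 2^n)] up to a constant, where [A(r)] is [r^(- k alpha)]
   times the integral of [|prod_j f_j(x_j) - prod_j f_j(x)|] over [B(x,r)^k] and the
   weights [w_n = phi(2^(n-1)) 2^(n k alpha)] are summable because [s(phi)] is finite.
   At a common Lebesgue point [x] of the [f_j], the function [A] is bounded, since
   the integral of [|f_j|] over a set [B] is at most [C (1 + mu B)], and [A(r)] tends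
   to [0] with [r], because
   [|prod a_j - prod c_j| <= prod (|a_j - c_j| + |c_j|) - prod |c_j|], whose
   right-hand side is a difference of products over the coordinates.

   Lebesgue differentiation rests on one fact: if a finite measure [nu]
   vanishes on a Borel set [B], then [nu(B(x,r)) = o(r^alpha)] for almost every
   [x] in [B].  It follows from the Vitali covering lemma applied to the balls
   contained in an open set [U] containing [B] with [nu U] small.  It is used for
   the densities [(f - q)^+] on [{f <= q}] and [(- f - q)^+] on [{- f <= q}],
   with [q] rational. *)

From HB Require Import structures.
Require Import Defs.
From mathcomp Require Import all_boot all_order all_algebra.
From mathcomp Require Import all_classical all_reals all_analysis.
From mathcomp Require Import measurable_realfun ess_sup_inf ring lra.
Import Order.TTheory GRing.Theory Num.Theory.
Import numFieldNormedType.Exports.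
Local Open Scope classical_set_scope.
Local Open Scope ring_scope.

Lemma exists_integral_measure {disp : measure_display} {T : measurableType disp}
    {R : realType} (mu : {measure set T -> \bar R}) (g : T -> \bar R) :
  measurable_fun [set: T] g -> (forall x, (0 <= g x)%E) ->
  exists nu : {measure set T -> \bar R}, forall A, nu A = (\int[mu]_(x in A) g x)%E.
Proof.
move=> mg g0; pose m A := (\int[mu]_(x in A) g x)%E.
have m0 : m set0 = 0%E by exact: integral_set0.
have m_ge0 A : (0 <= m A)%E by exact: integral_ge0.
have m_add : semi_sigma_additive m by exact: semi_sigma_additive_nng_induced.
pose M := isMeasure.Build _ _ _ m m0 m_ge0 m_add.
pose nu : {measure set T -> \bar R} := HB.pack m M.
by exists nu.
Qed.

(** * Lebesgue differentiation in Ahlfors regular spaces *)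

Section ahlfors_space.
Context {R : realType} {disp : measure_display} {X : measurableType disp}.
Variables (d : X -> X -> R) (mu : {measure set X -> \bar R}).
Variables kappa alpha gamma Gamma : R.
Hypotheses (d_ge0 : forall x y, 0 <= d x y) (d_sym : forall x y, d x y = d y x).
Hypotheses (d_refl : forall x, d x x = 0) (kappa_ge1 : 1 <= kappa).
Hypothesis d_tri : forall x y z, d x z <= kappa * (d x y + d y z).
Hypotheses (alpha_gt0 : 0 < alpha) (gamma_gt0 : 0 < gamma).
Hypothesis mu_ball : forall (x : X) (r : R), 0 < r ->
  ((gamma * r `^ alpha)%:E <= mu (qball d x r) <= (Gamma * r `^ alpha)%:E)%E.
Hypothesis ball_measurable : forall (x : X) (r : R), 0 < r -> measurable (qball d x r).
Hypothesis ball_open : forall (x : X) (r : R), 0 < r -> qopen d (qball d x r).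

Local Notation ball := (qball d).

Let kappa_gt0 : 0 < kappa. Proof. exact: lt_le_trans kappa_ge1. Qed.

(** * Balls, finite nets and measurability of open sets *)

Lemma qball_center x r : 0 < r -> ball x r x.
Proof. by rewrite /qball/= d_refl. Qed.

Lemma qball_sym x y r : ball x r y = ball y r x.
Proof. by rewrite /qball/= d_sym. Qed.

Lemma le_qball x r s : r <= s -> ball x r `<=` ball x s.
Proof. by move=> rs y; rewrite /qball/= => /lt_le_trans; exact. Qed.

Lemma qball_sub x z r s : kappa * (d z x + r) <= s -> ball x r `<=` ball z s.
Proof.
move=> rs y; rewrite /qball/= => xy; apply: lt_le_trans rs.
by apply: le_lt_trans (d_tri z x y) _; rewrite ltr_pM2l// ltrD2l.
Qed.

(** Packing: balls of radius [e / (2 * kappa)] about [e]-separated points are disjoint, have mass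
    bounded below, and lie in one ball of finite mass, so a separated family cannot grow forever. *)
Lemma exists_finite_net (x0 : X) (N e : R) : 0 < N -> 0 < e ->
  exists s : seq X, forall x, ball x0 N x -> exists2 z, z \in s & d x z < e.
Proof.
move=> N0 e0; apply: contrapT => nonet.
pose r := e / (2 * kappa).
have r0 : 0 < r by rewrite divr_gt0// mulr_gt0.
pose U (s : seq X) := \big[setU/set0]_(z <- s) ball z r.
have mU s : measurable (U s).
  by apply: bigsetU_measurable => z _; exact: ball_measurable.
have step (s : seq X) : exists2 x, ball x0 N x & forall z, z \in s -> e <= d x z.
  apply: contrapT => H; apply: nonet; exists s => x x0x.
  apply: contrapT => H'; apply: H; exists x => // z zs.
  by rewrite leNgt; apply/negP => xz; apply: H'; exists z.
have sep (m : nat) : exists2 s, U s `<=` ball x0 (kappa * (N + r)) &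
    ((m%:R * (gamma * r `^ alpha))%:E <= mu (U s))%E.
  elim: m => [|m [s sub IH]].
    by exists [::]; rewrite /U big_nil ?mul0r ?measure0.
  have [x x0x xs] := step s.
  exists (x :: s); rewrite /U big_cons.
    rewrite subUset; split=> //; apply: qball_sub.
    by rewrite ler_pM2l// lerD2r; exact: ltW.
  rewrite measureU//; [|exact: ball_measurable|exact: mU|].
    rewrite -natr1 mulrDl mul1r addrC EFinD leeD//.
    by have /andP[] := mu_ball x r r0.
  rewrite -subset0 => y [xy]; rewrite -bigcup_seq => -[z /= zs zy].
  have := xs z zs; rewrite leNgt => /negP; apply.
  apply: (le_lt_trans (d_tri x y z)).
  rewrite (_ : e = kappa * (r + r)).
    by rewrite ltr_pM2l// ltrD// d_sym.
  by rewrite /r; field; rewrite gt_eqF.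
have M0 : 0 < kappa * (N + r) by rewrite mulr_gt0// addr_gt0.
have /andP[_ le_M] := mu_ball x0 _ M0.
set M := Gamma * _ in le_M.
have c0 : 0 < gamma * r `^ alpha by rewrite mulr_gt0// powR_gt0.
have [s sub] := sep (Num.bound (M / (gamma * r `^ alpha))).
apply/negP; rewrite -ltNge; apply: (@le_lt_trans _ _ M%:E).
  apply: le_trans le_M; apply: le_measure => //; rewrite inE//.
  exact: ball_measurable.
rewrite lte_fin -ltr_pdivrMr//.
apply: archi_boundP; apply: divr_ge0 (ltW c0).
by rewrite -lee_fin; apply: le_trans le_M.
Qed.

(** Nets of the balls of integer radius about one point, at all scales [1 / (m + 1)], are countably
    many finite lists; the sequence runs through their entries. *)
Lemma exists_dense_sequence :
  exists D : nat -> X, forall x r, 0 < r -> exists n, d x (D n) < r.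
Proof.
pose x0 : X := point.
have /choice[net netP] (nm : nat * nat) : exists s : seq X, forall x,
    ball x0 nm.1.+1%:R x -> exists2 z, z \in s & d x z < nm.2.+1%:R^-1.
  by apply: exists_finite_net; rewrite ?invr_gt0 ltr0n.
exists (fun i => if unpickle i is Some (n, j) then nth x0 (net n) j else x0).
move=> x r r0; set nm := (Num.bound (d x0 x), Num.bound r^-1).
have [|z zn xz] := netP nm x.
  by rewrite /qball/=; apply: (lt_trans (archi_boundP _)); rewrite ?ltr_nat.
exists (pickle (nm, index z (net nm))).
rewrite pickleK nth_index//; apply: lt_trans xz _.
rewrite invf_plt ?posrE ?ltr0n//.
by apply: (lt_trans (archi_boundP _)); rewrite ?ltr_nat// invr_ge0 ltW.
Qed.

(** By separability an open set is a countable union of balls with centers in a dense sequence and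
    radii [1 / (n + 1)]. *)
Lemma qopen_measurable U : qopen d U -> measurable U.
Proof.
move=> oU; have [D denseD] := exists_dense_sequence.
rewrite (_ : U = \bigcup_i \bigcup_n
    (if `[< ball (D i) n.+1%:R^-1 `<=` U >] then ball (D i) n.+1%:R^-1 else set0)).
  apply: bigcupT_measurable => i; apply: bigcupT_measurable => n.
  by case: ifPn => // _; apply: ball_measurable; rewrite invr_gt0 ltr0n.
apply/seteqP; split => x; last by move=> [i _ [n _]]; case: asboolP => // + ?; apply.
move=> Ux; have [r r0 xrU] := oU x Ux.
have [n nr] : exists n : nat, kappa * (n.+1%:R^-1 + n.+1%:R^-1) <= r.
  pose b := Num.bound (2 * kappa / r); exists b; set m : R := b.+1%:R.
  rewrite (_ : _ * _ = 2 * kappa / m); last by ring.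
  rewrite ler_pdivrMr ?ltr0n// -ler_pdivrMl// mulrC ltW//.
  apply: (lt_trans (archi_boundP _)); rewrite ?ltr_nat//.
  by rewrite divr_ge0// ?mulr_ge0// ltW.
have n0 : 0 < n.+1%:R^-1 :> R by rewrite invr_gt0 ltr0n.
have [i xi] := denseD x _ n0.
exists i => //; exists n => //; case: asboolP => [_|[]].
  by rewrite qball_sym.
apply: subset_trans xrU; apply: qball_sub; apply: le_trans nr.
by rewrite ler_pM2l// lerD2r ltW.
Qed.

(** * Regularity of finite measures *)

Lemma qopenI U V : qopen d U -> qopen d V -> qopen d (U `&` V).
Proof.
move=> oU oV x [/oU[r r0 rU] /oV[s s0 sV]].
exists (Num.min r s); first by rewrite lt_min r0.
by move=> y xy; split; [apply: rU|apply: sV]; apply: le_qball xy;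
  rewrite ge_min lexx ?orbT.
Qed.

Lemma qopen_bigcup I (P : set I) (U : I -> set X) :
  (forall i, P i -> qopen d (U i)) -> qopen d (\bigcup_(i in P) U i).
Proof.
move=> oU x [i Pi Uix]; have [r r0 rU] := oU i Pi x Uix.
by exists r => //; apply: subset_trans rU _; exact: bigcup_sup.
Qed.

Lemma closed_bigsetU (K : nat -> set X) n : (forall i, qopen d (~` K i)) ->
  qopen d (~` \big[setU/set0]_(i < n) K i).
Proof.
move=> oK; elim: n => [|n IH]; last by rewrite big_ord_recr setCU; exact: qopenI.
by rewrite big_ord0 setC0 => x _; exists 1.
Qed.

(** Continuity from above along the decreasing differences of [A] and [F n], available because [nu]
    is finite. *)
Lemma exists_measure_setD_lt (nu : {measure set X -> \bar R}) (A : set X)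
    (F : nat -> set X) (c : \bar R) :
  (nu [set: X] < +oo)%E -> measurable A -> (forall n, measurable (F n)) ->
  nondecreasing_seq F -> (nu (A `\` \bigcup_n F n) < c)%E ->
  exists n, (nu (A `\` F n) < c)%E.
Proof.
move=> nu_fin mA mF ndF nuc; apply: contrapT => nex.
have mD n : measurable (A `\` F n) by exact: measurableD.
have : nu \o (fun n => A `\` F n) @ \oo --> nu (\bigcap_n (A `\` F n)).
  apply: nonincreasing_cvg_mu => //.
  - apply: le_lt_trans nu_fin; apply: le_measure; rewrite ?inE//.
  - exact: bigcapT_measurable.
  - by move=> m n /ndF/subsetPset mn; apply/subsetPset; exact: setDS.
have -> : \bigcap_n (A `\` F n) = A `\` \bigcup_n F n.
  apply/seteqP; split => x.
    by move=> AF; split=> [|[n _ Fx]]; [have [] := AF 0%N I|have [] := AF n I].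
  by move=> [Ax nF] n _; split=> // Fx; apply: nF; exists n.
move=> nucvg; move: nuc; apply/negP; rewrite -leNgt -(cvg_lim _ nucvg)//.
apply: lime_ge; first by apply/cvg_ex; eexists; exact: nucvg.
apply: nearW => n /=; rewrite leNgt; apply/negP => nlt.
by apply: nex; exists n.
Qed.

(* An open set [U] is the union of the closed sets of those [y] with
   [B(y, 1/n)] contained in [U]; the sets [d x y <= r] could not be used instead, as
   they need not be closed. *)
Lemma finite_measure_regular (nu : {measure set X -> \bar R}) A (e : R) :
  (nu [set: X] < +oo)%E -> qball_sigma_algebra d A -> 0 < e ->
  exists K U, [/\ qopen d (~` K), qopen d U, K `<=` A, A `<=` U &
    (nu (U `\` K) < e%:E)%E].
Proof.
move=> nu_fin BA; move: e.
have closed_measurable K : qopen d (~` K) -> measurable K.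
  by move=> /qopen_measurable/measurableC; rewrite setCK.
pose G := [set A : set X | forall e, 0 < e -> exists K U, [/\ qopen d (~` K),
  qopen d U, K `<=` A, A `<=` U & (nu (U `\` K) < e%:E)%E]].
suff /(_ A BA) : qball_sigma_algebra d `<=` G by [].
apply: smallest_sub; last first.
  move=> _ [x [r [r0 ->]]] e e0.
  pose F n := [set y | ball y n.+1%:R^-1 `<=` ball x r].
  have oF n : qopen d (~` F n).
    rewrite (_ : ~` F n = \bigcup_(w in ~` ball x r) ball w n.+1%:R^-1).
      by apply: qopen_bigcup => w _; apply: ball_open; rewrite invr_gt0.
    apply/seteqP; split => y.
      move=> Fy; apply: contrapT => H; apply: Fy => z yz.
      by apply: contrapT => xz; apply: H; exists z => //; rewrite qball_sym.
    by move=> [w wx wy] Fy; apply: wx; apply: Fy; rewrite qball_sym.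
  have UF : \bigcup_n F n = ball x r.
    apply/seteqP; split => y.
      by move=> [n _]; apply; apply: qball_center; rewrite invr_gt0.
    move=> /(ball_open x r r0)[s s0 sub]; exists (Num.bound s^-1) => //.
    apply: subset_trans sub; apply: le_qball.
    rewrite invf_ple ?posrE// ltW//; apply: (lt_trans (archi_boundP _)).
      by rewrite invr_ge0 ltW.
    by rewrite ltr_nat.
  have [||||n nun] := @exists_measure_setD_lt nu (ball x r) F e%:E nu_fin.
  - exact: ball_measurable.
  - by move=> n; exact: closed_measurable.
  - move=> m n mn; apply/subsetPset => y; apply: subset_trans; apply: le_qball.
    by rewrite lef_pV2 ?posrE// ler_nat.
  - by rewrite UF setDv measure0.
  exists (F n), (ball x r); split => //; first exact: ball_open.
  by rewrite -UF; exact: bigcup_sup.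
split.
- move=> e e0; exists set0, set0; split=> //; last by rewrite setD0 measure0.
  by rewrite setC0 => x _; exists 1.
- move=> B GB e /GB[K [U [oK oU KB BU nuUK]]]; rewrite setTD.
  exists (~` U), (~` K); rewrite setCK; split => //; [exact: subsetC..|].
  by rewrite setDE setCK setIC -setDE.
move=> B GB e e0.
have e20 n : 0 < e / 2 / (2 ^ n.+1)%:R.
  by rewrite !divr_gt0// ltr0n expn_gt0.
have /choice[KU KUP] n : exists KU : set X * set X, [/\ qopen d (~` KU.1),
    qopen d KU.2, KU.1 `<=` B n, B n `<=` KU.2 &
    (nu (KU.2 `\` KU.1) < (e / 2 / (2 ^ n.+1)%:R)%:E)%E].
  by have [K [U KUP]] := GB n _ (e20 n); exists (K, U).
pose K n := (KU n).1; pose U := \bigcup_n (KU n).2.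
have oU n : qopen d (KU n).2 by have [] := KUP n.
have oK n : qopen d (~` K n) by have [] := KUP n.
have mU := qopen_measurable _ (oU _); have mK := closed_measurable _ (oK _).
have mUT : measurable U by exact: bigcupT_measurable.
(* A countable union of closed sets need not be closed, so the inner set is a finite partial union.
   The errors sum to at most [e / 2], which leaves room for the strict inequality. *)
have [|||n nun] := @exists_measure_setD_lt nu U
    (fun n => \big[setU/set0]_(i < n.+1) K i) e%:E nu_fin mUT.
- by move=> n; exact: bigsetU_measurable.
- by move=> m n mn; apply/subsetPset; apply: subset_bigsetU.
- rewrite bigcup_bigsetU_bigcup.
  apply: (@le_lt_trans _ _ (\sum_(n <oo) nu ((KU n).2 `\` K n))%E).
    apply: measure_sigma_subadditive.
    + by move=> n; exact: measurableD.
    + by apply: measurableD => //; exact: bigcupT_measurable.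
    + move=> x [[n _ Ux] nK]; exists n => //; split => // Kx.
      by apply: nK; exists n.
  apply: (@le_lt_trans _ _ (e / 2)%:E); last by rewrite lte_fin; lra.
  apply: le_trans (epsilon_trick0 xpredT _); last by lra.
  by apply: lee_nneseries => // n _; apply/ltW; have [] := KUP n.
exists (\big[setU/set0]_(i < n.+1) K i), U; split => //.
- exact: closed_bigsetU.
- by apply: qopen_bigcup => i _.
- rewrite -bigcup_mkord; apply: bigcup_sub => i _ x.
  by have [_ _ KB _ _] := KUP i => /KB Bx; exists i.
- by apply: subset_bigcup => i _; have [] := KUP i.
Qed.

(** * The Vitali covering estimate *)

Lemma exists_largest_radius (b0 : X * R) (s : seq (X * R)) :
  exists2 b, b \in b0 :: s & forall c, c \in b0 :: s -> c.2 <= b.2.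
Proof.
elim: s b0 => [|b1 s IH] b0.
  by exists b0; rewrite ?mem_head// => c; rewrite inE => /eqP ->.
have [b bs bmax] := IH b1; have [bb0|b0b] := leP b.2 b0.2.
  exists b0; rewrite ?mem_head// => c; rewrite inE => /predU1P[->//|/bmax].
  by move=> /le_trans; exact.
exists b; first by rewrite inE bs orbT.
by move=> c; rewrite inE => /predU1P[->|/bmax//]; exact: ltW.
Qed.

Local Notation balls s := (\bigcup_(b in [set` s]) ball b.1 b.2).

(** Enlarging a ball by the factor [kappa * (1 + 2 * kappa)] makes it contain every ball of no
    larger radius that meets it. *)
Let C := Gamma * (kappa * (1 + 2 * kappa)) `^ alpha.

Let C_ge0 : 0 <= C.
Proof.
apply: mulr_ge0; last exact: powR_ge0.
have := mu_ball point 1 ltr01; rewrite powR1 !mulr1 => /andP[_].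
by rewrite -lee_fin; exact: le_trans.
Qed.

(** Greedy selection: a ball [b] of largest radius is kept, and the balls meeting it are absorbed in
    its enlargement, whose [mu]-mass is at most [C / l] times the [nu]-mass of [b]. The remaining
    balls are disjoint from [b], so the [nu]-masses add up. *)
Lemma finite_vitali (nu : {measure set X -> \bar R}) (l : R) (s : seq (X * R)) :
  0 < l ->
  (forall b, b \in s ->
    0 < b.2 /\ ((l * b.2 `^ alpha)%:E <= nu (ball b.1 b.2))%E) ->
  (mu (balls s) <= (C / l)%:E * nu (balls s))%E.
Proof.
move=> l0; have [n] := ubnP (size s); elim: n s => // n IH [|b0 s] /=.
  by rewrite set_nil bigcup_set0 measure0 mule_ge0// lee_fin divr_ge0// ltW.
rewrite ltnS; set t := b0 :: s => sn tP.
have [b bt bmax] := exists_largest_radius b0 s; rewrite -/t in bt bmax.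
have mballs (u : seq (X * R)) : {subset u <= t} -> measurable (balls u).
  move=> ut; apply: fin_bigcup_measurable; first exact: finite_seq.
  by move=> c /= /ut/tP[c0 _]; exact: ball_measurable.
have [b_gt0 lb] := tP b bt.
pose disj (c : X * R) := `[< ball b.1 b.2 `&` ball c.1 c.2 = set0 >].
pose u := [seq c <- t | disj c].
have ut : {subset u <= t} by move=> c; rewrite mem_filter => /andP[].
have mb : measurable (ball b.1 b.2) by exact: ball_measurable.
(* The list shrinks strictly because [b] meets itself and is discarded. *)
have u_size : (size u < n)%N.
  rewrite (leq_trans _ sn)// -[X in (_ < X)%N]/(size t) /u size_filter.
  rewrite -(count_predC disj t) -[X in (X < _)%N]addn0 ltn_add2l -has_count.
  apply/hasP; exists b => //=; apply/asboolP => /seteqP[+ _] => /(_ b.1).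
  by apply; split; exact: qball_center.
have {}IH := IH u u_size (fun c cu => tP c (ut c cu)).
pose r := kappa * (1 + 2 * kappa) * b.2.
have r0 : 0 < r by rewrite !mulr_gt0// addr_gt0// mulr_gt0.
have sub : balls t `<=` ball b.1 r `|` balls u.
  move=> y [c /= ct cy]; case: (boolP (disj c)) => [cb|/asboolPn/eqP/set0P[v [bv cv]]].
    by right; exists c => //=; rewrite mem_filter cb.
  left; move: cy; apply: qball_sub; rewrite /r -mulrA ler_pM2l//.
  apply: le_trans (_ : kappa * (b.2 + c.2) + c.2 <= _).
    rewrite lerD2r; apply: le_trans (d_tri _ v _) _.
    by rewrite ler_pM2l// lerD// ltW// d_sym.
  have cb := bmax c ct.
  have : kappa * (b.2 + c.2) <= kappa * (b.2 + b.2) by rewrite ler_pM2l// lerD2l.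
  by move=> ?; rewrite mulrDl mul1r; lra.
apply: (@le_trans _ _ (mu (ball b.1 r) + mu (balls u))%E).
  apply: le_trans (measureU2 _ _ _); [|exact: ball_measurable|exact: mballs].
  apply: le_measure => //; rewrite inE; first exact: mballs.
  by apply: measurableU; [exact: ball_measurable|exact: mballs].
apply: (@le_trans _ _ ((C / l)%:E * (nu (ball b.1 b.2) + nu (balls u)))%E).
  rewrite ge0_muleDr//; apply: leeD => //.
  have /andP[_ /le_trans] := mu_ball b.1 r r0; apply.
  apply: le_trans (lee_wpmul2l _ lb); last by rewrite lee_fin divr_ge0// ltW.
  rewrite -EFinM lee_fin mulrA divfK ?gt_eqF// /C /r powRM -?mulrA//.
    by rewrite mulr_ge0 ?addr_ge0 ?mulr_ge0 ?ltW.
  exact: ltW.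
apply: lee_wpmul2l; first by rewrite lee_fin divr_ge0// ltW.
rewrite -measureU//.
- apply: le_measure; rewrite ?inE; [|exact: mballs|].
    by apply: measurableU => //; exact: mballs.
  rewrite subUset; split; first by move=> y by_; exists b.
  by move=> y [c cu cy]; exists c => //; exact: ut.
- exact: mballs.
- rewrite -subset0 => y [by_ [c /=]]; rewrite mem_filter => /andP[/asboolP bc _] cy.
  by have /seteqP[+ _] := bc; apply; split; [exact: by_|].
Qed.

(** The finite bound does not depend on the number of balls, so it passes to the union by continuity
    from below. *)
Lemma countable_vitali (nu : {measure set X -> \bar R}) (l : R) (U : set X)
    (P : set nat) (z : nat -> X) (r : nat -> R) :
  0 < l -> measurable U ->
  (forall n, P n -> [/\ 0 < r n, ball (z n) (r n) `<=` U &
    ((l * r n `^ alpha)%:E <= nu (ball (z n) (r n)))%E]) ->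
  (mu (\bigcup_(n in P) ball (z n) (r n)) <= (C / l)%:E * nu U)%E.
Proof.
move=> l0 mU Pn; rewrite bigcup_mkcond.
set F := fun n => _.
have mF n : measurable (F n).
  rewrite /F; case: ifPn => //; rewrite inE => /Pn[? _ _].
  exact: ball_measurable.
pose G n := \big[setU/set0]_(i < n.+1) F i.
have mG n : measurable (G n) by exact: bigsetU_measurable.
have : mu \o G @ \oo --> mu (\bigcup_n G n).
  apply: nondecreasing_cvg_mu => //; first exact: bigcupT_measurable.
  by move=> m n mn; apply/subsetPset; exact: subset_bigsetU.
rewrite bigcup_bigsetU_bigcup => Gcvg; rewrite -(cvg_lim _ Gcvg)//.
apply: lime_le; first by apply/cvg_ex; eexists; exact: Gcvg.
apply: nearW => n /=.
pose s := [seq (z i, r i) | i <- iota 0 n.+1 & i \in P].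
have sP (b : X * R) : b \in s -> exists2 i, P i & b = (z i, r i).
  by case/mapP => i; rewrite mem_filter => /andP[/set_mem Pi _] ->; exists i.
have GE : G n = balls s.
  rewrite /G -bigcup_mkord; apply/seteqP; split => x.
    move=> [i /= ni]; rewrite /F; case: ifPn => // iP ix.
    by exists (z i, r i) => //=; apply: map_f; rewrite mem_filter iP mem_iota.
  move=> [b /= /mapP[i]]; rewrite mem_filter mem_iota /= add0n => /andP[iP ni] -> ix.
  by exists i => //; rewrite /F iP.
rewrite GE; apply: le_trans (@finite_vitali nu l s l0 _) _.
  by move=> b /sP[i /Pn[? _ ?]] ->.
apply: lee_wpmul2l; first by rewrite lee_fin divr_ge0// ltW.
apply: le_measure; rewrite ?inE//; first by rewrite -GE.
by move=> x [b /= /sP[i /Pn[_ sub _]] ->]; exact: sub.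
Qed.

(** * Density of a finite measure at the points of a null set *)

Lemma qball_sigma_algebra_measurable A : qball_sigma_algebra d A -> measurable A.
Proof.
suff : qball_sigma_algebra d `<=` measurable by exact.
apply: smallest_sub; last by move=> _ [x [r [r0 ->]]]; exact: ball_measurable.
split => //; first by move=> B; rewrite setTD; exact: measurableC.
by move=> F mF; exact: bigcupT_measurable.
Qed.

(** Open sets [U n] containing [B] have small [nu]-mass. Balls of large density about the points of
    [S] fit inside [U n], and the covering estimate bounds the [mu]-mass of their union by a
    multiple of [nu (U n)]. *)
Lemma large_density_negligible (nu : {measure set X -> \bar R}) (B : set X) (l : R) :
  (nu [set: X] < +oo)%E -> qball_sigma_algebra d B -> nu B = 0%E -> 0 < l ->
  mu.-negligible [set x | B x /\ forall r0, 0 < r0 ->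
    exists r, [/\ 0 < r, r < r0 & ((l * r `^ alpha)%:E < nu (ball x r))%E]].
Proof.
move=> nu_fin BB nuB0 l0; set S := [set x | _].
have mB := qball_sigma_algebra_measurable _ BB.
(* The part of [U] inside [K] lies in [B], hence is [nu]-null, so [nu U] is at most the regularity
   error. *)
have /choice[U UP] n : exists U, [/\ qopen d U, B `<=` U & (nu U < n.+1%:R^-1%:E)%E].
  have n0 : 0 < n.+1%:R^-1 :> R by rewrite invr_gt0.
  have [K [U [oK oU KB BU nuUK]]] := finite_measure_regular _ _ _ nu_fin BB n0.
  exists U; split => //; apply: le_lt_trans nuUK.
  have mU := qopen_measurable _ oU.
  have mK : measurable K by rewrite -(setCK K); apply/measurableC/qopen_measurable.
  rewrite (measureDI _ mU mK) -[leRHS]adde0 leeD// -nuB0.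
  by apply: le_measure; rewrite ?inE//; [exact: measurableI|move=> x [_ /KB]].
have [D denseD] := exists_dense_sequence.
(* For countability, a ball of radius [r] is replaced by one with center in the dense sequence and
   rational radius between [2 * kappa * r] and [3 * kappa * r]; [l'] is the density that survives
   the replacement. *)
pose z (m : nat) := if @unpickle (nat * rat)%type m is Some (i, q) then D i else point.
pose rad (m : nat) : R := if @unpickle (nat * rat)%type m is Some (i, q) then ratr q else 0.
pose l' := l / (3 * kappa) `^ alpha.
have l'0 : 0 < l' by rewrite divr_gt0// powR_gt0// mulr_gt0.
pose P n : set nat := [set m | [/\ 0 < rad m, ball (z m) (rad m) `<=` U n &
  ((l' * rad m `^ alpha)%:E <= nu (ball (z m) (rad m)))%E]].
pose W n := \bigcup_(m in P n) ball (z m) (rad m).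
have mW n : measurable (W n).
  by apply: bigcup_measurable => m [rm _ _]; exact: ball_measurable.
have SW n : S `<=` W n.
  move=> x [Bx large]; have [oU BU _] := UP n.
  have [s s0 sU] := oU x (BU x Bx).
  (* The replacement ball has its center within [r] of [x] and radius below [3 * kappa * r], so it
     lies in the ball of radius [t * r] about [x]. *)
  pose t := kappa * (1 + 3 * kappa).
  have t0 : 0 < t by rewrite mulr_gt0// addr_gt0// mulr_gt0.
  have [r [r0 rs nur]] := large (s / t) (divr_gt0 s0 t0).
  have : 2 * kappa * r < 3 * kappa * r by rewrite ltr_pM2r// ltr_pM2r// ltr_nat.
  move=> /rat_in_itvoo[q]; rewrite in_itv/= => /andP[q2 q3].
  have [i xi] := denseD x r r0.
  have kr : 0 < kappa * r by rewrite mulr_gt0.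
  have q0 : 0 < ratr q :> R by apply: lt_trans q2; rewrite -mulrA; lra.
  exists (pickle (i, q)); rewrite /P /z /rad /= pickleK; last first.
    rewrite qball_sym; apply: lt_trans q2; apply: lt_le_trans xi _.
    by rewrite ler_peMl// ?ltW//; have := kappa_ge1; lra.
  have sub : ball x r `<=` ball (D i) (ratr q).
    apply: qball_sub; apply: le_trans (ltW q2).
    rewrite (_ : 2 * kappa * r = kappa * (r + r)); last by ring.
    by rewrite ler_pM2l// lerD2r d_sym ltW.
  split => //.
    apply: subset_trans sU; apply: qball_sub; apply: (@le_trans _ _ (t * r)).
      rewrite /t -mulrA ler_pM2l// mulrDl mul1r lerD// ltW//.
    by rewrite -ler_pdivlMl// mulrC ltW.
  apply: le_trans (le_measure _ _ _ sub); rewrite ?inE; try exact: ball_measurable.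
  apply: le_trans (ltW nur); rewrite lee_fin /l' mulrAC ler_pdivrMr.
    have k30 : 0 <= 3 * kappa by rewrite mulr_ge0// ltW.
    rewrite -mulrA ler_pM2l// -(powRM alpha (ltW r0) k30) mulrC.
    by apply: ge0_ler_powR; rewrite ?nnegrE; [exact: ltW..|rewrite mulr_ge0// ltW|exact: ltW].
  by rewrite powR_gt0// mulr_gt0.
exists (\bigcap_n W n); split; last by move=> x Sx n _; exact: SW.
  exact: bigcapT_measurable.
apply/eqP; rewrite eq_le measure_ge0 andbT.
apply/lee_addgt0Pr => e e0; rewrite add0e.
pose n := Num.bound (C / l' / e).
have C'0 : 0 <= C / l' by rewrite divr_ge0// ltW.
apply: (@le_trans _ _ (mu (W n))).
  apply: le_measure; rewrite ?inE//; first exact: bigcapT_measurable.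
  exact: bigcap_inf.
have [oU _ nuU] := UP n.
apply: le_trans (@countable_vitali nu l' (U n) (P n) z rad l'0 _ _) _ => //.
  exact: qopen_measurable.
apply: le_trans (lee_wpmul2l _ (ltW nuU)) _; first by rewrite lee_fin.
rewrite -EFinM lee_fin ler_pdivrMr ?ltr0n// -ler_pdivrMl// mulrC ltW//.
apply: lt_trans (archi_boundP _) _; first by rewrite divr_ge0// ltW.
by rewrite ltr_nat.
Qed.

(** A bare set function is allowed, so that the definition applies to indefinite integrals whose
    integrand depends on [x]. *)
Definition vanishing_density (nu : set X -> \bar R) (x : X) : Prop :=
  forall e, 0 < e -> exists2 r0, 0 < r0 & forall r, 0 < r -> r < r0 ->
    (nu (ball x r) <= (e * r `^ alpha)%:E)%E.

(** The thresholds [1 / (n + 1)] give countably many negligible exceptional sets. *)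
Lemma ae_vanishing_density (nu : {measure set X -> \bar R}) (B : set X) :
  (nu [set: X] < +oo)%E -> qball_sigma_algebra d B -> nu B = 0%E ->
  {ae mu, forall x, B x -> vanishing_density nu x}.
Proof.
move=> nu_fin BB nuB0.
have : {ae mu, forall x, forall n : nat, B x -> exists2 r0, 0 < r0 &
    forall r, 0 < r -> r < r0 -> (nu (ball x r) <= (n.+1%:R^-1 * r `^ alpha)%:E)%E}.
  apply: ae_foralln => n.
  have n0 : 0 < n.+1%:R^-1 :> R by rewrite invr_gt0.
  apply: negligibleS (large_density_negligible _ _ _ nu_fin BB nuB0 n0).
  move=> x /= /not_implyP[Bx nex]; split => // r0 r00.
  apply: contrapT => nr; apply: nex; exists r0 => // r rp rr0.
  by rewrite leNgt; apply/negP => ?; apply: nr; exists r.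
apply: filterS => x xP Bx e e0.
have [r0 r00 r0P] := xP (Num.bound e^-1) Bx.
exists r0 => // r rp rr0; apply: le_trans (r0P r rp rr0) _.
rewrite lee_fin ler_wpM2r ?powR_ge0// invf_ple ?posrE// ltW//.
apply: lt_trans (archi_boundP _) _; first by rewrite invr_ge0 ltW.
by rewrite ltr_nat.
Qed.

(** * Lebesgue points *)

Lemma Gamma_gt0 : 0 < Gamma.
Proof.
have /andP[lo hi] := mu_ball point 1 ltr01.
by have := le_trans lo hi; rewrite lee_fin powR1 !mulr1; exact: lt_le_trans.
Qed.

(** Restriction to the balls [V n] makes the measure with density [g] finite, and [borel_regular]
    supplies a Borel hull of the part of [E] in [V n]. The hull adds only a [mu]-null set, so the
    restricted measure vanishes on it as well. *)
Lemma ae_vanishing_integral (g : X -> R) (E : set X) :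
  borel_regular mu d -> measurable_fun [set: X] g -> (forall x, 0 <= g x) ->
  (forall x r, 0 < r -> (\int[mu]_(y in ball x r) (g y)%:E < +oo)%E) ->
  measurable E -> (forall x, E x -> g x = 0) ->
  {ae mu, forall x, E x ->
    vanishing_density (fun A => \int[mu]_(y in A) (g y)%:E)%E x}.
Proof.
move=> reg mg g0 g_fin mE gE; pose x0 : X := point.
pose V (n : nat) := ball x0 n.+1%:R.
have mV n : measurable (V n) by exact: ball_measurable.
have mgE : measurable_fun [set: X] (EFin \o g) by exact/measurable_EFinP.
have {}g0 x : (0 <= (g x)%:E)%E by rewrite lee_fin.
have loc n : {ae mu, forall x, (E `&` V n) x ->
    vanishing_density (fun A => \int[mu]_(y in A `&` V n) (g y)%:E)%E x}.
  have [nu nuE] : exists nu : {measure set X -> \bar R},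
      forall A, nu A = (\int[mu]_(y in A `&` V n) (g y)%:E)%E.
    have [||nu nuE] := @exists_integral_measure _ X R mu ((EFin \o g) \_ (V n)).
    - by apply/(measurable_restrictT _ (mV n)).1; exact: measurable_funTS.
    - by apply: erestrict_ge0 => y _; exact: g0.
    by exists nu => A; rewrite nuE integral_mkcondr.
  have mEV : measurable (E `&` V n) by exact: measurableI.
  have [B [BB EB muB]] := reg _ mEV.
  have mB := qball_sigma_algebra_measurable _ BB.
  have muBE : mu (B `\` (E `&` V n)) = 0%E.
    have fin : (mu (E `&` V n) < +oo)%E.
      apply: le_lt_trans (_ : mu (V n) < +oo)%E.
        by apply: le_measure; rewrite ?inE.
      by have /andP[_ /le_lt_trans] := mu_ball x0 n.+1%:R (ltr0Sn _ _); apply; exact: ltry.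
    have finB : (mu B < +oo)%E by rewrite muB.
    by rewrite measureD// setIidr// [X in (X - _)%E]muB subee// ge0_fin_numE.
  have nu_fin : (nu [set: X] < +oo)%E by rewrite nuE setTI g_fin.
  have nuB : nu B = 0%E.
    rewrite (measureDI _ mB mEV) [X in (X + _)%E]nuE [X in (_ + X)%E]nuE.
    rewrite [X in (X + _)%E]null_set_integral ?add0e.
    - apply: integral0_eq => x [[_ [Ex _]] _]; rewrite gE//.
    - by apply: measurableI => //; exact: measurableD.
    - exact: measurable_funTS.
    - apply: (@subset_measure0 _ _ _ mu _ _ _ _ _ muBE) => //.
      + by apply: measurableI => //; exact: measurableD.
      + exact: measurableD.
  have := ae_vanishing_density nu B nu_fin BB nuB; apply: filterS => x xP EVx.
  move=> e e0; have [r0 r00 r0P] := xP (EB x EVx) e e0.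
  by exists r0 => // r rp rr0; rewrite -nuE; exact: r0P.
apply: filterS (ae_foralln loc) => x xP Ex e e0.
pose n := Num.bound (d x0 x).
have Vx : V n x.
  by rewrite /V/qball/=; apply: lt_trans (archi_boundP _) _; rewrite ?ltr_nat.
have [r0 r00 r0P] := xP n (conj Ex Vx) e e0.
(* Small balls about [x] stay inside the open ball [V n], where the restriction changes nothing. *)
have [s s0 sV] := ball_open _ _ (ltr0Sn _ _) _ Vx.
exists (Num.min r0 s); first by rewrite lt_min r00.
move=> r rp; rewrite lt_min => /andP[rr0 rs].
have := r0P r rp rr0; rewrite setIidl//.
by apply: subset_trans sV; exact/le_qball/ltW.
Qed.

(** If [b] and [a] lie above [f x] and [- f x] by less than [t], then [|f y - f x| <= (f y - b)^+ +
    (- f y - a)^+ + t]. Each positive part vanishes on a sublevel set containing [x]; taking [a] and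
    [b] rational keeps the exceptional set negligible. *)
Lemma lebesgue_differentiation (f : X -> R) :
  borel_regular mu d -> measurable_fun [set: X] f ->
  (forall x r, 0 < r -> (\int[mu]_(y in ball x r) `|f y|%:E < +oo)%E) ->
  {ae mu, forall x, vanishing_density (fun A => \int[mu]_(y in A) `|f y - f x|%:E)%E x}.
Proof.
move=> reg mf f_fin.
have mu_fin x r : 0 < r -> (mu (ball x r) < +oo)%E.
  by move=> r0; have /andP[_ /le_lt_trans] := mu_ball x r r0; apply; exact: ltry.
have level (h : X -> R) (q : R) : measurable_fun [set: X] h ->
    (forall x r, 0 < r -> (\int[mu]_(y in ball x r) `|h y|%:E < +oo)%E) ->
    {ae mu, forall x, h x <= q ->
      vanishing_density (fun A => \int[mu]_(y in A) (Num.max (h y - q) 0)%:E)%E x}.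
  move=> mh h_fin; apply: (ae_vanishing_integral _ [set x | h x <= q]) => //.
  - by apply: measurable_maxr => //; exact: measurable_funB.
  - by move=> x; rewrite le_max lexx orbT.
  - move=> x r r0; have mb := ball_measurable x r r0.
    apply: le_lt_trans (_ : \int[mu]_(y in ball x r) (`|h y|%:E + `|q|%:E) < +oo)%E.
      apply: ge0_le_integral => //.
      + by move=> y _; rewrite lee_fin le_max lexx orbT.
      + apply/measurable_EFinP; apply: measurable_maxr => //.
        by apply: measurable_funB => //; exact: measurable_funTS.
      + apply: emeasurable_funD => //; apply/measurable_EFinP.
        by apply: measurableT_comp => //; exact: measurable_funTS.
      + move=> y _; rewrite -EFinD lee_fin ge_max addr_ge0// andbT.
        by apply: le_trans (ler_norm _) (ler_normB _ _).
    rewrite ge0_integralD//; last first.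
      by apply/measurable_EFinP; apply: measurableT_comp => //; exact: measurable_funTS.
    by rewrite lte_add_pinfty ?h_fin// integral_cst// lte_mul_pinfty// mu_fin.
  - have -> : [set x | h x <= q] = h @^-1` `]-oo, q].
      by apply/seteqP; split => x /=; rewrite in_itv.
    by rewrite -[X in measurable X]setTI; exact: mh.
  - by move=> x /= hq; apply/max_idPr; rewrite subr_le0.
have levels (h : X -> R) : measurable_fun [set: X] h ->
    (forall x r, 0 < r -> (\int[mu]_(y in ball x r) `|h y|%:E < +oo)%E) ->
    {ae mu, forall x, forall q : rat, h x <= ratr q ->
      vanishing_density (fun A => \int[mu]_(y in A) (Num.max (h y - ratr q) 0)%:E)%E x}.
  move=> mh h_fin.
  have := @ae_foralln _ _ _ mu (fun n x => forall q : rat, unpickle n = Some q ->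
      h x <= ratr q -> vanishing_density
      (fun A => \int[mu]_(y in A) (Num.max (h y - ratr q) 0)%:E)%E x).
  move=> /(_ _)/filterS; apply.
    by move=> x xP q; apply: (xP (pickle q)); rewrite pickleK.
  move=> n; case: (unpickle n) => [q|]; last exact: aeW.
  by apply: filterS (level h (ratr q) mh h_fin) => x xP _ [<-].
have mNf : measurable_fun [set: X] (\- f) by exact: measurable_funN.
have Nf_fin x r : 0 < r -> (\int[mu]_(y in ball x r) `|(\- f) y|%:E < +oo)%E.
  by move=> r0; under eq_integral do rewrite normrN; exact: f_fin.
apply: filterS2 (levels f mf f_fin) (levels (\- f) mNf Nf_fin) => x up down e e0.
(* The constant [t] then contributes at most [t * Gamma * r^alpha], which is [e / 3 * r^alpha]. *)
have G0 := Gamma_gt0; pose t := e / (3 * Gamma).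
have t0 : 0 < t by rewrite divr_gt0// mulr_gt0.
have e30 : 0 < e / 3 by rewrite divr_gt0.
have : f x < f x + t by rewrite ltrDl.
move=> /rat_in_itvoo[b]; rewrite in_itv/= => /andP[xb bx].
have : - f x < - f x + t by rewrite ltrDl.
move=> /rat_in_itvoo[a]; rewrite in_itv/= => /andP[xa ax].
have [r1 r10 r1P] := up b (ltW xb) _ e30.
have [r2 r20 r2P] := down a (ltW xa) _ e30.
exists (Num.min r1 r2); first by rewrite lt_min r10.
move=> r r0; rewrite lt_min => /andP[rr1 rr2].
have mb := ball_measurable x r r0.
have m1 : measurable_fun (ball x r) (fun y => (Num.max (f y - ratr b) 0)%:E).
  apply/measurable_EFinP; apply: measurable_maxr => //.
  by apply: measurable_funB => //; exact: measurable_funTS.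
have m2 : measurable_fun (ball x r) (fun y => (Num.max (- f y - ratr a) 0)%:E).
  apply/measurable_EFinP; apply: measurable_maxr => //.
  by apply: measurable_funB => //; exact: measurable_funTS.
have max0 (z : R) : (0 <= (Num.max z 0)%:E)%E by rewrite lee_fin le_max lexx orbT.
apply: (@le_trans _ _ (\int[mu]_(y in ball x r) ((Num.max (f y - ratr b) 0)%:E +
    ((Num.max (- f y - ratr a) 0)%:E + t%:E)))%E).
  apply: ge0_le_integral => //.
  - apply/measurable_EFinP; apply: measurableT_comp => //.
    by apply: measurable_funB => //; exact: measurable_funTS.
  - by apply: emeasurable_funD => //; exact: emeasurable_funD.
  - move=> y _; rewrite -!EFinD lee_fin ler_norml.
    have : f y - ratr b <= Num.max (f y - ratr b) 0 by rewrite le_max lexx.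
    have : - f y - ratr a <= Num.max (- f y - ratr a) 0 by rewrite le_max lexx.
    have : 0 <= Num.max (f y - ratr b) 0 by rewrite le_max lexx orbT.
    have : 0 <= Num.max (- f y - ratr a) 0 by rewrite le_max lexx orbT.
    by move: bx ax xa xb; lra.
rewrite ge0_integralD//; last 2 first.
  - by move=> y _; rewrite adde_ge0// lee_fin ltW.
  - exact: emeasurable_funD.
rewrite ge0_integralD//; last by move=> y _; rewrite lee_fin ltW.
rewrite integral_cst//.
have -> : (e * r `^ alpha)%:E = ((e / 3 * r `^ alpha)%:E +
    ((e / 3 * r `^ alpha)%:E + t%:E * (Gamma * r `^ alpha)%:E))%E.
  by rewrite -EFinM -!EFinD /t; congr EFin; field; rewrite gt_eqF.
apply: leeD; first exact: r1P.
apply: leeD; first exact: r2P.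
rewrite lee_pmul2l//; first by have /andP[] := mu_ball x r r0.
Qed.

End ahlfors_space.

(** * Integrals over powers of the space *)

(* On a set of finite measure [|f| <= 1 + |f|^p] replaces Hoelder's inequality. *)
Lemma Lfun_integral_bound {disp : measure_display} {T : measurableType disp}
    {R : realType} (mu : {measure set T -> \bar R}) (p : \bar R) (f : T -> R) :
  (1 < p)%E -> f \in Lfun mu p ->
  measurable_fun [set: T] f /\ exists2 C : R, 0 <= C & forall A, measurable A ->
    (\int[mu]_(x in A) `|f x|%:E <= C%:E * (1 + mu A))%E.
Proof.
move=> p1 fL.
have mf : measurable_fun [set: T] f by move: (sub_Lfun_mfun fL); rewrite inE.
have mfA A : measurable_fun A (fun x => `|f x|%:E).
  apply/measurable_EFinP; apply: measurableT_comp => //; exact: measurable_funTS.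
split=> //.
have : ('N[mu]_p[EFin \o f] < +oo)%E by move: (sub_Lfun_finLfun fL); rewrite inE.
case: p p1 fL => [r|_ _|//].
  rewrite lte_fin => r1 _; have r0 : 0 < r by apply: lt_trans r1.
  move=> /(poweR_lty r); rewrite poweR_Lnorm ?gt_eqF//=.
  set I := (\int[mu]_x _)%E => I_fin.
  have I0 : (0 <= I)%E by apply: integral_ge0 => x _; rewrite lee_fin powR_ge0.
  have mpow A : measurable_fun A (fun x => (`|f x| `^ r)%:E).
    apply/measurable_EFinP; apply: (measurableT_comp (measurable_powR r)).
    by apply: measurableT_comp => //; exact: measurable_funTS.
  (* The integral is at most [mu A + I], hence at most [(1 + I) * (1 + mu A)]. *)
  exists (1 + fine I); first by rewrite addr_ge0// fine_ge0.
  move=> A mA; apply: (@le_trans _ _ (\int[mu]_(x in A) (1 + (`|f x| `^ r)%:E))%E).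
    apply: ge0_le_integral => //.
    - exact: emeasurable_funD.
    - move=> x _; rewrite -EFinD lee_fin.
      have [f1|f1] := leP `|f x| 1; first by rewrite -[leLHS]addr0 lerD ?powR_ge0.
      rewrite -[leLHS]add0r lerD// -[leLHS]powRr1//.
      by apply: ler_powR; exact: ltW.
  rewrite ge0_integralD//.
  rewrite integral_cst// mul1e.
  have IA : (\int[mu]_(x in A) (`|f x| `^ r)%:E <= I)%E.
    by apply: ge0_subset_integral => // x _; rewrite lee_fin powR_ge0.
  rewrite EFinD ge0_muleDl ?fine_ge0 ?lee_fin ?fine_ge0//.
  rewrite mul1e fineK ?ge0_fin_numE// ge0_muleDr// mule1.
  rewrite -addeA addeCA leeD2l// addeCA (le_trans IA)// leeDl//.
  by rewrite adde_ge0// mule_ge0.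
(* For [p = +oo] the norm is the essential supremum if the space has positive measure; otherwise all
   integrals are [0]. *)
rewrite unlock; case: ifPn => [muT|].
  set S := ess_sup _ _ => S_fin.
  have S0 : (0 <= S)%E by by apply: ess_sup_gee => //; apply: nearW => x; exact: abse_ge0.
  exists (fine S); first by rewrite fine_ge0.
  move=> A mA; rewrite fineK ?ge0_fin_numE//.
  apply: (@le_trans _ _ (\int[mu]_(x in A) S)%E); last first.
    by rewrite integral_cst// lee_wpmul2l// leeDr.
  apply: ae_ge0_le_integral => //.
  by apply: filterS (ess_sup_ge mu (abse \o (EFin \o f))) => x.
rewrite -leNgt measure_le0 => /eqP muT _; exists 0 => // A mA.
rewrite null_set_integral ?mul0e//.
by apply: subset_measure0 muT => //; exact: measurableT.
Qed.

Lemma measurable_prod_tnth {disp : measure_display} {X : measurableType disp}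
    {R : realType} k (F : 'I_k -> X -> R) :
  (forall i, measurable_fun [set: X] (F i)) ->
  measurable_fun [set: k.-tuple X] (fun y => \prod_(i < k) F i (tnth y i)).
Proof.
move=> mF; apply: measurable_prod => i _.
by apply: measurableT_comp => //; exact: measurable_tnth.
Qed.

(** Tonelli's theorem splits off the first coordinate, after the integral is pulled back along the
    pushforward. *)
Lemma integral_power_measure_prod {R : realType} {disp : measure_display}
    {X : measurableType disp} (mu : {sigma_finite_measure set X -> \bar R}) k
    (F : 'I_k -> X -> R) :
  (forall i, measurable_fun [set: X] (F i)) -> (forall i x, 0 <= F i x) ->
  (\int[power_measure mu k]_y (\prod_(i < k) F i (tnth y i))%:E =
   \prod_(i < k) \int[mu]_x (F i x)%:E)%E.
Proof.
elim: k F => [|k IH] F mF F0.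
  rewrite big_ord0 (eq_integral (cst 1%E)); last by move=> y _; rewrite big_ord0.
  by rewrite integral_cst// mul1e /= diracT.
have [m mE] := power_measure_sigma_finite mu k.
pose c (z : X * k.-tuple X) : k.+1.-tuple X := [tuple of z.1 :: z.2].
have mc : measurable_fun [set: X * k.-tuple X] c.
  by apply: measurable_cons; [exact: measurable_fst|exact: measurable_snd].
have mP : measurable_fun [set: k.+1.-tuple X]
    (fun y => (\prod_(i < k.+1) F i (tnth y i))%:E).
  by apply/measurable_EFinP; exact: measurable_prod_tnth.
have P0 (y : k.+1.-tuple X) : (0 <= (\prod_(i < k.+1) F i (tnth y i))%:E)%E.
  by rewrite lee_fin prodr_ge0.
have -> : power_measure mu k.+1 = pushforward (mu \x m)%E c by rewrite /= mE.
rewrite (ge0_integral_pushforward mc)// preimage_setT.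
rewrite (fubini_tonelli1 (m1 := mu) (m2 := m)); last 2 first.
- exact: (measurableT_comp mP mc).
- by move=> z; exact: P0.
rewrite /fubini_F big_ord_recl.
pose Q (y : k.-tuple X) := \prod_(i < k) F (lift ord0 i) (tnth y i).
have mQ : measurable_fun [set: k.-tuple X] Q.
  exact: (@measurable_prod_tnth _ _ _ k (fun i => F (lift ord0 i))).
have Q0 y : 0 <= Q y by apply: prodr_ge0.
rewrite -IH// mE -/Q -ge0_integralZr//.
- apply: eq_integral => x _; rewrite -ge0_integralZl//.
  + apply: eq_integral => y _ /=; rewrite -EFinM big_ord_recl; congr (_ * _)%:E.
    by apply: eq_bigr => i _; rewrite tnthS.
  + exact/measurable_EFinP.
  + by move=> y _; rewrite lee_fin; exact: Q0.
  + by rewrite lee_fin F0.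
- exact/measurable_EFinP.
- by move=> x _; rewrite lee_fin F0.
- by apply: integral_ge0 => y _; rewrite lee_fin; exact: Q0.
Qed.

(* Holds for arbitrary functions, since the integral of a nonnegative function
   is a supremum over the simple functions below it. *)
Lemma le_integral_nonmeasurable {disp : measure_display} {T : measurableType disp}
    {R : realType} (mu : {measure set T -> \bar R}) (D : set T) (f g : T -> \bar R) :
  (forall x, D x -> (0 <= f x)%E) -> (forall x, D x -> (f x <= g x)%E) ->
  (\int[mu]_(x in D) f x <= \int[mu]_(x in D) g x)%E.
Proof.
move=> f0 fg; have g0 x : D x -> (0 <= g x)%E.
  by move=> Dx; exact: le_trans (f0 x Dx) (fg x Dx).
rewrite !ge0_integralE//; apply: le_ereal_sup => _ [h hf <-].
exists h => // x; apply: le_trans (hf x) _.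
by rewrite /patch; case: ifPn => // /set_mem; exact: fg.
Qed.

(** Induction through [a A - c B = (a - c) A + c (A - B)], where [|A| <= A']. *)
Lemma normr_prodB_le {R : realDomainType} (I : Type) (s : seq I) (P : pred I)
    (a c : I -> R) :
  `|\prod_(i <- s | P i) a i - \prod_(i <- s | P i) c i| <=
  \prod_(i <- s | P i) (`|a i - c i| + `|c i|) - \prod_(i <- s | P i) `|c i|.
Proof.
elim: s => [|i s IH]; first by rewrite !big_nil !subrr normr0.
rewrite !big_cons; case: ifP => // _.
set A := \prod_(j <- s | P j) a j; set B := \prod_(j <- s | P j) c j.
set A' := \prod_(j <- s | P j) (_ + _); set B' := \prod_(j <- s | P j) `|_|.
rewrite -/A -/B -/A' -/B' in IH.
have AA' : `|A| <= A'.
  rewrite /A /A' normr_prod ler_prod// => j _; rewrite normr_ge0/=.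
  by rewrite -[X in `|X|](subrK (c j)) ler_normD.
rewrite (_ : a i * A - c i * B = (a i - c i) * A + c i * (A - B)); last by ring.
apply: le_trans (ler_normD _ _) _; rewrite !normrM.
rewrite [leRHS](_ : _ = `|a i - c i| * A' + `|c i| * (A' - B')); last by ring.
by rewrite lerD// ler_wpM2l.
Qed.

(** * Dyadic estimates for the hypermetric kernel *)

Section hypermetric_bounds.
Context {R : realType} {X : Type} (d : X -> X -> R) (kappa : R).
Hypotheses (d_ge0 : forall x y, 0 <= d x y) (d_refl : forall x, d x x = 0).
Hypotheses (kappa_ge1 : 1 <= kappa).
Hypothesis d_tri : forall x y z, d x z <= kappa * (d x y + d y z).

Lemma hypermetric_ge0 n (x : n.+1.-tuple X) : 0 <= hypermetric d x.
Proof.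
apply: lb_le_inf.
  by exists (\big[Num.max/0]_(i < n.+1) d (tnth x i) (tnth x ord0)), (tnth x ord0).
by move=> _ [u _ <-]; exact: le_trans (d_ge0 _ _) (le_bigmax _ _ ord0).
Qed.

(** The infimum is tested at [u = x]. *)
Lemma hypermetric_le k (x : X) (y : k.-tuple X) (r : R) : 0 <= r ->
  (forall i, d x (tnth y i) <= r) -> (forall y z, d y z = d z y) ->
  hypermetric d [tuple of x :: y] <= r.
Proof.
move=> r0 xy d_sym.
apply: (@le_trans _ _ (\big[Num.max/0]_(i < k.+1) d (tnth [tuple of x :: y] i) x)).
  apply: ge_inf; last by exists x.
  by exists 0 => _ [u _ <-]; exact: le_trans (d_ge0 _ _) (le_bigmax _ _ ord0).
apply: bigmax_le => // i _; have [j ->|->] := unliftP ord0 i.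
  by rewrite tnthS d_sym.
by rewrite tnth0 d_refl.
Qed.

(** For every [u] the distances from [u] to [x] and to [tnth y i] are at most the maximum; passing
    through [u] costs the factor [2 * kappa]. *)
Lemma le_hypermetric k (x : X) (y : k.-tuple X) (i : 'I_k) :
  (forall y z, d y z = d z y) ->
  d x (tnth y i) <= 2 * kappa * hypermetric d [tuple of x :: y].
Proof.
move=> d_sym; have k0 : 0 < 2 * kappa by rewrite mulr_gt0// (lt_le_trans _ kappa_ge1).
rewrite -ler_pdivrMl//; apply: lb_le_inf.
  by exists (\big[Num.max/0]_(i < k.+1) d (tnth [tuple of x :: y] i) x), x.
move=> _ [u _ <-]; rewrite ler_pdivrMl//; set M := \big[_/_]_(_ < _) _.
have xM : d x u <= M by apply: le_trans (le_bigmax _ _ ord0); rewrite tnth0.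
have yM : d (tnth y i) u <= M.
  by apply: le_trans (le_bigmax _ _ (lift ord0 i)); rewrite tnthS.
apply: le_trans (d_tri x u _) _.
rewrite (_ : 2 * kappa * M = kappa * (M + M)); last by ring.
by rewrite ler_pM2l ?(lt_le_trans _ kappa_ge1)// lerD// d_sym.
Qed.

End hypermetric_bounds.

(* The largest value of [phi] on the shell [2 ^ (n - 1) <= t < 2 ^ n] (on [t < 1] if
   [n = 0]), times the volume, up to a constant, of the cube of radius [2 ^ n]. *)
Definition dyadic_weight {R : realType} (phi : R -> R) (beta : R) (n : nat) : R :=
  phi (if n is m.+1 then 2 ^+ m else 0) * (2 ^+ n) `^ beta.

Lemma dyadic_weight_ge0 {R : realType} (phi : R -> R) (beta : R) (n : nat) :
  (forall t, 0 <= t -> 0 <= phi t) -> 0 <= dyadic_weight phi beta n.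
Proof.
move=> phi0; rewrite /dyadic_weight mulr_ge0 ?powR_ge0// phi0//.
by case: n => // n; exact: exprn_ge0.
Qed.

(** On [J n], of length [2^n], the integrand is at least [c n], and the weight of index [n + 2] is a
    constant multiple of [c n * 2^n]. *)
Lemma summable_dyadic_weight {R : realType} (phi : R -> R) (beta : R) :
  (forall t, 0 <= t -> 0 <= phi t) ->
  (forall s t, 0 <= s -> s <= t -> phi t <= phi s) ->
  (\int[lebesgue_measure]_(t in `]0%R, +oo[) (phi t * t `^ (beta - 1))%:E < +oo)%E ->
  0 < beta ->
  (\sum_(n <oo) (dyadic_weight phi beta n)%:E < +oo)%E.
Proof.
move=> phi0 phi_noninc phi_fin beta0.
have w0 n := dyadic_weight_ge0 phi beta n phi0.
have pow0 n : 0 < 2 ^+ n :> R by exact: exprn_gt0.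
(* [t^(beta - 1)] is split into [t^beta] and [t^-1], bounded below at opposite ends of the interval,
   since [beta - 1] may have either sign. *)
pose c n : R := phi (2 ^+ n.+1) * ((2 ^+ n) `^ beta / 2 ^+ n.+1).
have c0 n : 0 <= c n.
  by rewrite /c !mulr_ge0 ?powR_ge0 ?invr_ge0 ?phi0// exprn_ge0.
pose J n : set R := `]2 ^+ n, 2 ^+ n.+1]%classic.
have mJ n : measurable (J n) by exact: measurable_itv.
have csum : (\sum_(n <oo) (c n * 2 ^+ n)%:E < +oo)%E.
  apply: le_lt_trans phi_fin.
  have -> : (\sum_(n <oo) (c n * 2 ^+ n)%:E = \int[lebesgue_measure]_(t in `]0%R, +oo[)
      \sum_(n <oo) (c n * \1_(J n) t)%:E)%E.
    rewrite integral_nneseries//=.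
    - apply: eq_eseriesr => n _.
      under eq_integral do rewrite EFinM.
      rewrite ge0_integralZl_EFin//; last first.
        by apply/measurable_EFinP; apply: measurable_indic; exact: mJ.
      have sub : J n `<=` `]0%R, +oo[.
        by move=> t; rewrite /J /= !in_itv/= andbT => /andP[/(lt_trans _)->].
      rewrite integral_indic; [|exact: measurable_itv|exact: mJ].
      rewrite (setIidl sub).
      have muJ : lebesgue_measure (J n) = (2 ^+ n.+1 - 2 ^+ n)%:E.
        by rewrite lebesgue_measure_itv/= lte_fin ltr_eXn2l ?ltr1n// ltnS leqnn.
      rewrite [X in (_ * X)%E](_ : _ = (2 ^+ n.+1 - 2 ^+ n)%:E); last exact: muJ.
      rewrite -EFinM; congr (_ * _)%:E.
      by rewrite exprS mulr_natl mulr2n addrK.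
    - move=> n; apply/measurable_EFinP; apply: measurable_funM => //.
      by apply: measurable_indic; exact: mJ.
    - by move=> n t _; rewrite lee_fin mulr_ge0.
  apply: le_integral_nonmeasurable => t.
    by move=> _; apply: nneseries_ge0 => n _ _; rewrite lee_fin mulr_ge0.
  rewrite /= in_itv/= andbT => t0.
  have h0 : (0 <= (phi t * t `^ (beta - 1))%:E)%E.
    by rewrite lee_fin mulr_ge0 ?powR_ge0// phi0// ltW.
  (* The half-open intervals are disjoint, so at most one term of the series is nonzero at [t], and
     none if [t <= 1]. *)
  have [[n Jn]|nJ] := pselect (exists n, J n t); last first.
    rewrite eseries0// => n _ _; rewrite indicE memNset ?mulr0// => Jn.
    by apply: nJ; exists n.
  rewrite (@nneseriesD1 _ _ n)//; last by move=> m _; rewrite lee_fin mulr_ge0.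
  rewrite eseries0 ?adde0; last first.
    move=> m _ mn; rewrite indicE memNset ?mulr0// => Jm.
    move: Jn Jm mn; rewrite /J /= !in_itv/= => /andP[nt tn] /andP[mt tm].
    rewrite eqn_leq; have := lt_le_trans nt tm; have := lt_le_trans mt tn.
    by rewrite !ltr_eXn2l ?ltr1n// !ltnS => -> ->.
  rewrite indicE mem_set// mulr1 lee_fin /c.
  move: Jn; rewrite /J /= in_itv/= => /andP[nt tn].
  apply: ler_pM; rewrite ?phi0 ?mulr_ge0 ?invr_ge0 ?powR_ge0 ?exprn_ge0//.
  - by apply: phi_noninc => //; exact: ltW.
  - rewrite powRB ?(gt_eqF t0) ?implybT// (powRr1 (ltW t0)); apply: ler_pM.
    + exact: powR_ge0.
    + by rewrite invr_ge0 ltW.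
    + by apply: ge0_ler_powR; rewrite ?nnegrE ?exprn_ge0// ltW.
    + by rewrite lef_pV2 ?posrE.
have e0 n : (0 <= (dyadic_weight phi beta n)%:E)%E by rewrite lee_fin.
(* The first two weights take [phi] at [0] and [1], which no [c n] bounds; they are finite and are
   split off. *)
rewrite (@nneseries_split _ _ 0 2)//; apply: lte_add_pinfty.
  by rewrite sumEFin ltry.
rewrite add0n -nneseries_addn//.
have wE n : dyadic_weight phi beta (n + 2) = (2 * 4 `^ beta) * (c n * 2 ^+ n).
  rewrite addn2 /dyadic_weight /c (exprS _ n.+1) (exprS _ n).
  rewrite mulrA powRM ?exprn_ge0// (_ : 2 * 2 = 4 :> R); last by ring.
  by field; rewrite gt_eqF.
under eq_eseriesr do rewrite wE EFinM.
rewrite nneseriesZl; last by move=> n _; rewrite lee_fin mulr_ge0// exprn_ge0.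
by rewrite lte_mul_pinfty// lee_fin mulr_ge0// powR_ge0.
Qed.

(** Dominated convergence for a series: the tail past [N] is small by summability and [A <= M],
    while the arguments [s * 2^n] with [n < N] all fall below [r0] once [s < r0 / 2^N]. *)
Lemma nneseries_dyadic_small {R : realType} (w : nat -> R) (A : R -> R) (M : R) :
  (forall n, 0 <= w n) -> (\sum_(n <oo) (w n)%:E < +oo)%E ->
  (forall r, 0 < r -> 0 <= A r <= M) ->
  (forall e, 0 < e -> exists2 r0, 0 < r0 & forall r, 0 < r -> r < r0 -> A r <= e) ->
  forall e, 0 < e -> exists2 s0, 0 < s0 & forall s, 0 < s -> s < s0 ->
    (\sum_(n <oo) (w n * A (s * 2 ^+ n))%:E <= e%:E)%E.
Proof.
move=> w0 w_fin AM A_small e e0.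
have pow0 n : 0 < 2 ^+ n :> R by exact: exprn_gt0.
have we0 n : (0 <= (w n)%:E)%E by rewrite lee_fin.
have M0 : 0 <= M by have /andP[/le_trans] := AM 1 ltr01; apply.
set W := (\sum_(n <oo) (w n)%:E)%E in w_fin.
have W0 : (0 <= W)%E by exact: nneseries_ge0.
have fW0 : 0 <= fine W by exact: fine_ge0.
pose eta := e / 2 / (fine W + 1).
have eta0 : 0 < eta by rewrite !divr_gt0// ltr_wpDl.
have [r0 r00 r0A] := A_small eta eta0.
pose tail := e / 2 / (M + 1).
have tail0 : 0 < tail by rewrite !divr_gt0// ltr_wpDl.
have [N Ntail] : exists N, (\sum_(N <= n <oo) (w n)%:E <= tail%:E)%E.
  have /fine_cvgP[fin] := nneseries_tail_cvg w_fin (fun n _ => we0 n).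
  move=> /cvgrPdist_le /(_ tail tail0)[N1 _ N1P].
  have [N2 _ N2P] := fin; exists (maxn N1 N2).
  have := N1P _ (leq_maxl N1 N2); have := N2P _ (leq_maxr N1 N2) => /= ffin.
  by rewrite sub0r normrN => /(le_trans (ler_norm _)); rewrite -lee_fin fineK.
exists (r0 / 2 ^+ N) => [|s sp]; first exact: divr_gt0.
rewrite ltr_pdivlMr// => sr0.
have sn0 n : 0 < s * 2 ^+ n by exact: mulr_gt0.
have wA0 n : (0 <= (w n * A (s * 2 ^+ n))%:E)%E.
  by rewrite lee_fin mulr_ge0//; have /andP[] := AM _ (sn0 n).
rewrite (@nneseries_split _ _ 0 N)// add0n.
have -> : e%:E = ((e / 2)%:E + (e / 2)%:E)%E by rewrite -EFinD -splitr.
apply: leeD.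
  apply: (@le_trans _ _ (eta%:E * \sum_(0 <= n < N) (w n)%:E)%E).
    rewrite ge0_sume_distrr//; rewrite big_nat [leRHS]big_nat; apply: lee_sum => n /andP[_ nN].
    rewrite -EFinM lee_fin mulrC ler_wpM2r//; apply: r0A => //.
    by apply: le_lt_trans sr0; rewrite ler_pM2l// ler_eXn2l ?ltr1n// ltnW.
  apply: (@le_trans _ _ (eta%:E * W)%E).
    apply: lee_wpmul2l; first by rewrite lee_fin ltW.
    exact: nneseries_lim_ge.
  rewrite -[W]fineK ?ge0_fin_numE// -EFinM lee_fin /eta mulrAC.
  by rewrite ler_pdivrMr ?ltr_wpDl// ler_wpM2l ?lerDl// divr_ge0// ltW.
apply: (@le_trans _ _ (M%:E * \sum_(N <= n <oo) (w n)%:E)%E).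
  rewrite -nneseriesZl//; apply: lee_nneseries => // n _.
  by rewrite -EFinM lee_fin mulrC ler_wpM2r//; have /andP[] := AM _ (sn0 n).
apply: le_trans (lee_wpmul2l _ Ntail) _; first by rewrite lee_fin.
rewrite -EFinM lee_fin /tail mulrA (mulrC M).
by rewrite ler_pdivrMr ?ltr_wpDl// ler_wpM2l ?lerDl// divr_ge0// ltW.
Qed.

(** Gives a bound linear in [t]; the restriction [t <= 1] is what bounds [t + c i] by [1 + c i]. *)
Lemma prod_add_subr_le {R : realDomainType} (I : Type) (s : seq I) (P : pred I)
    (c : I -> R) (t : R) : (forall i, 0 <= c i) -> 0 <= t -> t <= 1 ->
  \prod_(i <- s | P i) (t + c i) - \prod_(i <- s | P i) c i <=
  t * \prod_(i <- s | P i) (1 + c i).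
Proof.
move=> c0 t0 t1; elim: s => [|i s IH]; first by rewrite !big_nil subrr mulr1.
rewrite !big_cons; case: ifP => // _.
set A := \prod_(j <- s | P j) (t + c j); set B := \prod_(j <- s | P j) c j.
set D := \prod_(j <- s | P j) (1 + c j); rewrite -/A -/B -/D in IH.
have AD : A <= D.
  by rewrite /A /D ler_prod// => j _; rewrite addr_ge0//= lerD2r.
rewrite [leLHS](_ : _ = t * A + c i * (A - B)); last by ring.
rewrite [leRHS](_ : _ = t * D + c i * (t * D)); last by ring.
by rewrite lerD// ler_wpM2l.
Qed.

(** * Cubes and estimates of the kernel *)

Definition qcube {R : realType} {X : Type} (d : X -> X -> R) k (x : X) (r : R) :
  set (k.-tuple X) := [set y | forall i, qball d x r (tnth y i)].
Arguments qcube {R X} d {k} x r.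

Lemma qcubeE {R : realType} {X : Type} (d : X -> X -> R) k (x : X) (r : R) (y : k.-tuple X) :
  (\1_(qcube d x r) y : R) = \prod_(i < k) \1_(qball d x r) (tnth y i).
Proof.
rewrite indicE; have [/set_mem xy|/negP xy] := boolP (_ \in _).
  by rewrite big1// => i _; rewrite indicE mem_set.
have [i xyi] : exists i, ~ qball d x r (tnth y i).
  by apply/existsNP => H; apply: xy; apply/mem_set.
by rewrite (bigD1 i)//= indicE memNset// mul0r.
Qed.

Lemma measurable_qcube {R : realType} {disp : measure_display}
    {X : measurableType disp} (d : X -> X -> R) k (x : X) (r : R) :
  measurable (qball d x r) -> measurable (qcube d x r : set (k.-tuple X)).
Proof.
move=> mb; rewrite (_ : qcube d x r = \bigcap_(i in [set: 'I_k])
    ((fun y : k.-tuple X => tnth y i) @^-1` qball d x r)); last first.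
  by apply/seteqP; split => [y H i _|y H i]; [exact: H|exact: (H i I)].
apply: fin_bigcap_measurable => // i _.
by rewrite -[X in measurable X]setTI; exact: measurable_tnth.
Qed.

Section hyper_estimates.
Context {R : realType} {disp : measure_display} {X : measurableType disp}.
Variables (d : X -> X -> R) (mu : {sigma_finite_measure set X -> \bar R}).
Variables kappa alpha gamma Gamma : R.
Hypotheses (d_ge0 : forall x y, 0 <= d x y) (d_sym : forall x y, d x y = d y x).
Hypotheses (d_refl : forall x, d x x = 0) (kappa_ge1 : 1 <= kappa).
Hypothesis d_tri : forall x y z, d x z <= kappa * (d x y + d y z).
Hypotheses (alpha_gt0 : 0 < alpha) (gamma_gt0 : 0 < gamma).
Hypothesis mu_ball : forall (x : X) (r : R), 0 < r ->
  ((gamma * r `^ alpha)%:E <= mu (qball d x r) <= (Gamma * r `^ alpha)%:E)%E.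
Hypothesis ball_measurable : forall (x : X) (r : R), 0 < r -> measurable (qball d x r).
Variables (k : nat) (phi : R -> R).
Hypotheses (phi_ge0 : forall t, 0 <= t -> 0 <= phi t).
Hypotheses (phi_noninc : forall s t, 0 <= s -> s <= t -> phi t <= phi s).

Local Notation ball := (qball d).
Local Notation beta := (k%:R * alpha).

Let kappa_gt0 : 0 < kappa. Proof. exact: lt_le_trans kappa_ge1. Qed.

Let powR_beta (r : R) : r `^ beta = (r `^ alpha) ^+ k.
Proof. by rewrite mulrC powRrM powR_mulrn ?powR_ge0. Qed.

Let volume (x : X) (r : R) := fine (mu (ball x r)).

Let volumeE x r : 0 < r -> mu (ball x r) = (volume x r)%:E.
Proof.
move=> r0; have /andP[_ hi] := mu_ball x r r0.
by rewrite fineK// ge0_fin_numE// (le_lt_trans hi)// ltry.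
Qed.

Let volume_bounds x r : 0 < r -> gamma * r `^ alpha <= volume x r <= Gamma * r `^ alpha.
Proof. by move=> r0; have := mu_ball x r r0; rewrite volumeE// !lee_fin. Qed.

Let volume_gt0 x r : 0 < r -> 0 < volume x r.
Proof.
move=> r0; have /andP[lo _] := volume_bounds x r r0.
by apply: lt_le_trans lo; rewrite mulr_gt0// powR_gt0.
Qed.

(** On the cube of radius [t * eps] the hypermetric is at most [t * eps], so the profile is at least
    [phi t] there. *)
Lemma hyper_mass_ge (x : X) (t eps : R) : 0 < t -> 0 < eps ->
  ((phi t * (gamma ^+ k * (t * eps) `^ beta))%:E <= hyper_mass d mu k phi eps x)%E.
Proof.
move=> t0 eps0; have te0 : 0 < t * eps by exact: mulr_gt0.
have [m mE] := power_measure_sigma_finite mu k.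
have mball := ball_measurable x _ te0.
have mcube : measurable (qcube d x (t * eps) : set (k.-tuple X)).
  exact: measurable_qcube.
have pt0 : 0 <= phi t by rewrite phi_ge0// ltW.
apply: (@le_trans _ _ (phi t * volume x (t * eps) ^+ k)%:E).
  rewrite lee_fin ler_wpM2l// powR_beta -exprMn.
  have /andP[lo _] := volume_bounds x _ te0.
  by rewrite lerXn2r ?nnegrE// ?mulr_ge0 ?powR_ge0 ?ltW ?volume_gt0.
have -> : ((phi t * volume x (t * eps) ^+ k)%:E =
    (phi t)%:E * power_measure mu k (qcube d x (t * eps)))%E.
  rewrite (@power_measureX _ _ _ mu k (fun=> ball x (t * eps)))// volumeE//.
  by rewrite prodEFin prodr_const card_ord EFinM.
rewrite /hyper_mass mE -[leLHS]integral_cst//.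
rewrite integral_mkcond; apply: le_integral_nonmeasurable => y _.
  by apply: erestrict_ge0 => z _; rewrite lee_fin.
have rho0 : 0 <= hypermetric d [tuple of x :: y] / eps.
  by apply: divr_ge0 (ltW eps0); exact: (hypermetric_ge0 d d_ge0).
rewrite patchE; case: ifPn => [/set_mem xy|_]; rewrite lee_fin; last exact: phi_ge0.
apply: phi_noninc => //; rewrite ler_pdivrMr//.
by apply: hypermetric_le => //; [exact: ltW|move=> i; exact/ltW/xy].
Qed.

(** [F] stands for the deviation of the product and [A r] for a bound on its integral over the cube,
    normalised by [r^beta]. In [(s * 2^n)^beta] the factor [(2^n)^beta] is absorbed by the
    weight. *)
Lemma integral_profile_le (x : X) (eps : R) (F : k.-tuple X -> R) (A : R -> R) :
  0 < eps -> measurable_fun [set: k.-tuple X] F -> (forall y, 0 <= F y) ->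
  (forall r, 0 < r -> 0 <= A r) ->
  (forall r, 0 < r ->
    (\int[power_measure mu k]_(y in qcube d x r) (F y)%:E <= (A r * r `^ beta)%:E)%E) ->
  (\int[power_measure mu k]_y ((hyper_profile d phi eps x y)%:E * (F y)%:E) <=
   ((2 * kappa * eps) `^ beta)%:E *
   \sum_(n <oo) (dyadic_weight phi beta n * A (2 * kappa * eps * 2 ^+ n))%:E)%E.
Proof.
move=> eps0 mF F0 A0 FA; have [m mE] := power_measure_sigma_finite mu k.
set s := 2 * kappa * eps.
have s0 : 0 < s by rewrite !mulr_gt0.
have sn0 n : 0 < s * 2 ^+ n by rewrite mulr_gt0// exprn_gt0.
pose b n := phi (if n is n'.+1 then 2 ^+ n' else 0).
have b0 n : 0 <= b n by rewrite phi_ge0//; case: n => // n; exact: exprn_ge0.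
pose G n := ((EFin \o F) \_ (qcube d x (s * 2 ^+ n))).
have G0 n y : (0 <= G n y)%E by apply: erestrict_ge0 => z _; rewrite lee_fin.
have bG0 n y : (0 <= (b n)%:E * G n y)%E by rewrite mule_ge0// lee_fin.
have mcube n : measurable (qcube d x (s * 2 ^+ n) : set (k.-tuple X)).
  by apply: measurable_qcube; exact: ball_measurable.
have mG n : measurable_fun [set: k.-tuple X] (G n).
  have [restr _] := measurable_restrictT (EFin \o F) (mcube n); apply: restr.
  by apply/measurable_EFinP; exact: measurable_funTS.
apply: (@le_trans _ _ (\int[power_measure mu k]_y \sum_(n <oo) ((b n)%:E * G n y))%E).
  have rho0 (y : k.-tuple X) : 0 <= hypermetric d [tuple of x :: y].
    exact: (hypermetric_ge0 d d_ge0).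
  have prof0 (y : k.-tuple X) : 0 <= hyper_profile d phi eps x y.
    by rewrite phi_ge0// divr_ge0// ltW.
  rewrite mE; apply: le_integral_nonmeasurable => y _.
    by rewrite mule_ge0// lee_fin.
  (* The smallest cube containing [y] selects the term of the series that dominates the profile at
     [y]. *)
  have [n yn n_min] : exists2 n, qcube d x (s * 2 ^+ n) y &
      forall j, qcube d x (s * 2 ^+ j) y -> (n <= j)%N.
    have ex : exists n, `[< qcube d x (s * 2 ^+ n) y >].
      pose M := \big[Num.max/0]_i d x (tnth y i).
      have M0 : 0 <= M / s.
        by apply: divr_ge0 (ltW s0); exact: bigmax_ge_id.
      exists (Num.bound (M / s)); apply/asboolP => i; rewrite /qball/=.
      apply: le_lt_trans (le_bigmax 0 (fun j => d x (tnth y j)) i) _.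
      rewrite mulrC -ltr_pdivrMr//.
      apply: lt_trans (archi_boundP M0) _.
      by rewrite -natrX ltr_nat ltn_expl.
    have [n /asboolP yn n_min] := ex_minnP ex.
    by exists n => // j /asboolP; exact: n_min.
  rewrite (@nneseriesD1 _ _ n)// -[leLHS]adde0; apply: leeD; last exact: nneseries_ge0.
  rewrite /G patchE mem_set// lee_wpmul2r ?lee_fin//.
  (* At index [0] the bound is [phi 0]. At index [n + 1], minimality gives a coordinate at distance
     at least [s * 2^n] from [x], so the hypermetric is at least [2^n * eps]. *)
  case: n yn n_min => [|n] yn n_min.
    by rewrite /b phi_noninc// divr_ge0// ltW.
  apply: phi_noninc; first exact: exprn_ge0.
  have [i yi] : exists i, ~ ball x (s * 2 ^+ n) (tnth y i).
    by apply/existsNP => /n_min; rewrite ltnn.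
  move/negP: yi; rewrite /qball/= -leNgt => yi.
  rewrite ler_pdivlMr// -(@ler_pM2l _ (2 * kappa)); last exact: mulr_gt0.
  rewrite (_ : _ * (_ * eps) = s * 2 ^+ n); last by rewrite /s; ring.
  by apply: le_trans yi _; exact: le_hypermetric.
rewrite mE integral_nneseries//; last first.
  by move=> n; apply: measurable_funeM.
rewrite -nneseriesZl; last first.
  by move=> n _; rewrite lee_fin mulr_ge0// ?A0// dyadic_weight_ge0.
apply: lee_nneseries => [n _ _|n _]; first exact: integral_ge0.
rewrite ge0_integralZl_EFin// /G -integral_mkcond -mE.
apply: le_trans (lee_wpmul2l _ (FA _ (sn0 n))) _; first by rewrite lee_fin.
rewrite -!EFinM lee_fin (powRM _ (ltW s0)) ?exprn_ge0// /dyadic_weight -/(b n).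
by rewrite le_eqVlt; apply/orP; left; apply/eqP; ring.
Qed.

(** In the bound of [normr_prodB_le] the first product integrates coordinate by coordinate, each
    factor giving at most [(a i + |c i|) * mu (ball x r)]; the subtracted constant is integrated
    exactly. *)
Lemma integral_qcube_prodB_le (f : 'I_k -> X -> R) (c a : 'I_k -> R) (x : X) (r : R) :
  0 < r -> (forall i, measurable_fun [set: X] (f i)) ->
  (forall i, (\int[mu]_(y in ball x r) `|f i y - c i|%:E <= (a i)%:E * mu (ball x r))%E) ->
  (\int[power_measure mu k]_(y in qcube d x r)
     `|\prod_(i < k) f i (tnth y i) - \prod_(i < k) c i|%:E <=
   (Gamma ^+ k * (\prod_(i < k) (a i + `|c i|) - \prod_(i < k) `|c i|) * r `^ beta)%:E)%E.
Proof.
move=> r0 mf fa; have [m mE] := power_measure_sigma_finite mu k.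
have mball := ball_measurable x r r0.
have mcube : measurable (qcube d x r : set (k.-tuple X)) by exact: measurable_qcube.
set v := volume x r; have v0 : 0 < v by exact: volume_gt0.
have a0 i : 0 <= a i.
  have : (0 <= (a i)%:E * mu (ball x r))%E.
    by apply: le_trans (fa i); apply: integral_ge0.
  by rewrite volumeE// -EFinM lee_fin pmulr_lge0.
pose g i y := `|f i y - c i| + `|c i|.
have g0 i y : 0 <= g i y by rewrite addr_ge0.
have mfc i : measurable_fun [set: X] (fun y => `|f i y - c i|).
  by apply: measurableT_comp => //; exact: measurable_funB.
have mg i : measurable_fun [set: X] (g i) by exact: measurable_funD.
pose F i y : R := \1_(ball x r) y * g i y.
have F0 i y : 0 <= F i y by rewrite mulr_ge0.
have mF i : measurable_fun [set: X] (F i).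
  by apply: measurable_funM => //; exact: measurable_indic.
have intF i : (\int[mu]_y (F i y)%:E <= ((a i + `|c i|) * v)%:E)%E.
  have -> : (\int[mu]_y (F i y)%:E = \int[mu]_(y in ball x r) (`|f i y - c i|%:E + `|c i|%:E))%E.
    rewrite [RHS]integral_mkcond; apply: eq_integral => y _.
    by rewrite patchE /F indicE; case: ifP => _; rewrite ?mul1r ?mul0r.
  rewrite ge0_integralD//; last by apply/measurable_EFinP; exact: measurable_funTS.
  rewrite integral_cst// volumeE// mulrDl EFinD -EFinM leeD2r//.
  by have := fa i; rewrite volumeE.
have intP : (\int[power_measure mu k]_(y in qcube d x r)
    (\prod_(i < k) g i (tnth y i))%:E <= (\prod_(i < k) (a i + `|c i|) * v ^+ k)%:E)%E.
  rewrite (_ : (\int[_]_(y in _) _)%E =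
      (\int[power_measure mu k]_y (\prod_(i < k) F i (tnth y i))%:E)%E); last first.
    rewrite mE integral_mkcond; apply: eq_integral => y _.
    rewrite big_split/= -qcubeE patchE indicE.
    by case: ifP => _; rewrite ?mul1r ?mul0r.
  rewrite integral_power_measure_prod//.
  have fin i : (\int[mu]_y (F i y)%:E)%E = (fine (\int[mu]_y (F i y)%:E))%:E.
    rewrite fineK// ge0_fin_numE; last by apply: integral_ge0 => y _; rewrite lee_fin.
    exact: le_lt_trans (intF i) (ltry _).
  under eq_bigr do rewrite fin.
  have vk : v ^+ k = \prod_(i < k) v by rewrite prodr_const card_ord.
  rewrite prodEFin lee_fin vk -big_split/=.
  apply: ler_prod => i _; rewrite fine_ge0; last first.
    by apply: integral_ge0 => y _; rewrite lee_fin.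
  by rewrite -lee_fin -fin; exact: intF.
set diff := _ - _.
have diff0 : 0 <= diff.
  by rewrite subr_ge0 ler_prod// => i _; rewrite normr_ge0/= lerDr.
pose c' := \prod_(i < k) `|c i|.
have c'0 : 0 <= c' by rewrite prodr_ge0.
apply: (@le_trans _ _ (v ^+ k * diff)%:E); last first.
  rewrite lee_fin powR_beta mulrAC -exprMn ler_wpM2r//.
  have /andP[_ hi] := volume_bounds x r r0.
  by rewrite lerXn2r ?nnegrE// ?ltW// (lt_le_trans v0 hi).
have -> : ((v ^+ k * diff)%:E =
    (\prod_(i < k) (a i + `|c i|) * v ^+ k)%:E - (c' * v ^+ k)%:E)%E.
  by rewrite -EFinB /diff -/c' -mulrBl mulrC.
(* The constant moves to the left, so that only integrals of nonnegative functions are added. *)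
rewrite leeBrDr//; apply: le_trans intP.
have -> : ((c' * v ^+ k)%:E = \int[power_measure mu k]_(y in qcube d x r) c'%:E)%E.
  rewrite mE integral_cst// -mE (@power_measureX _ _ _ mu k (fun=> ball x r))//.
  by under eq_bigr do rewrite volumeE//; rewrite prodEFin prodr_const card_ord EFinM.
have mfT : measurable_fun [set: k.-tuple X] (fun y => \prod_(i < k) f i (tnth y i)).
  exact: measurable_prod_tnth.
have mfc' : measurable_fun (qcube d x r)
    (fun y : k.-tuple X => `|\prod_(i < k) f i (tnth y i) - \prod_(i < k) c i|%:E).
  apply/measurable_EFinP/measurable_funTS; apply: measurableT_comp => //.
  exact: measurable_funB.
rewrite mE -ge0_integralD//.
apply: ge0_le_integral => //.
- by move=> y _; rewrite adde_ge0// lee_fin.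
- by apply: emeasurable_funD.
- by apply/measurable_EFinP/measurable_funTS; exact: measurable_prod_tnth.
- move=> y _; rewrite -EFinD lee_fin -lerBrDr.
  exact: (@normr_prodB_le _ _ _ _ (fun i => f i (tnth y i))).
Qed.

(** An infinite mass is covered too, its inverse being [0]. *)
Lemma inve_hyper_mass_le (x : X) (t eps : R) : 0 < t -> 0 < phi t -> 0 < eps ->
  ((hyper_mass d mu k phi eps x)^-1 <=
   ((phi t * (gamma ^+ k * (t * eps) `^ beta))^-1)%:E)%E.
Proof.
move=> t0 pt0 eps0; have := hyper_mass_ge x t eps t0 eps0.
have b0 : 0 < phi t * (gamma ^+ k * (t * eps) `^ beta).
  by rewrite !mulr_gt0 ?exprn_gt0 ?powR_gt0 ?mulr_gt0.
case: (hyper_mass _ _ _ _ _ _) => [r| |//]; last first.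
  by move=> _; rewrite invey lee_fin invr_ge0 ltW.
rewrite lee_fin => br; have r0 : 0 < r by exact: lt_le_trans br.
by rewrite inver gt_eqF// lee_fin lef_pV2.
Qed.

(** * Averages at a common Lebesgue point *)

Section differentiation_point.
Variables (f : 'I_k -> X -> R) (x : X).
Hypothesis mf : forall i, measurable_fun [set: X] (f i).
Hypothesis f_bound : forall i, exists2 C : R, 0 <= C & forall A, measurable A ->
  (\int[mu]_(y in A) `|f i y|%:E <= C%:E * (1 + mu A))%E.
Hypothesis f_density : forall i,
  vanishing_density d alpha (fun A => \int[mu]_(y in A) `|f i y - f i x|%:E)%E x.

Let deviation i r := (\int[mu]_(y in ball x r) `|f i y - f i x|%:E)%E.

Let average i r : R := fine (deviation i r) / volume x r.

Let deviation_ge0 i r : (0 <= deviation i r)%E.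
Proof. exact: integral_ge0. Qed.

(** A bound affine in the volume makes every deviation finite and controls the averages at large
    radii. *)
Let deviation_le i : exists2 C : R, 0 <= C &
  forall r, 0 < r -> (deviation i r <= (C + C * volume x r)%:E)%E.
Proof.
have [C C0 CP] := f_bound i; exists (C + `|f i x|) => [|r r0]; first exact: addr_ge0.
have mb := ball_measurable x r r0.
have mfi : measurable_fun (ball x r) (fun y => `|f i y|%:E).
  by apply/measurable_EFinP/measurable_funTS; exact: measurableT_comp.
apply: (@le_trans _ _ (\int[mu]_(y in ball x r) (`|f i y|%:E + `|f i x|%:E))%E).
  apply: ge0_le_integral => //.
  - apply/measurable_EFinP/measurable_funTS; apply: measurableT_comp => //.
    exact: measurable_funB.
  - exact: emeasurable_funD.
  - by move=> y _; rewrite -EFinD lee_fin ler_normB.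
rewrite ge0_integralD// integral_cst// volumeE//.
apply: (@le_trans _ _ (C%:E * (1 + (volume x r)%:E) + `|f i x|%:E * (volume x r)%:E)%E).
  by rewrite leeD2r// -volumeE//; exact: CP.
rewrite -!EFinM -EFinD lee_fin.
rewrite [leRHS](_ : _ = C * (1 + volume x r) + `|f i x| * volume x r + `|f i x|); last by ring.
by rewrite lerDl.
Qed.

Let deviation_fin i r : 0 < r -> deviation i r = ((average i r)%:E * mu (ball x r))%E.
Proof.
move=> r0; have [C C0 CP] := deviation_le i.
rewrite volumeE// -EFinM divfK ?gt_eqF ?volume_gt0// fineK// ge0_fin_numE//.
exact: le_lt_trans (CP r r0) (ltry _).
Qed.

Let average_ge0 i r : 0 < r -> 0 <= average i r.
Proof. by move=> r0; rewrite divr_ge0 ?fine_ge0// ltW ?volume_gt0. Qed.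

(** The density hypothesis is used with [t * gamma], since the volume is at least [gamma * r^alpha].
    A minimum over the finitely many [i] makes the radius uniform. *)
Let average_small t : 0 < t -> exists2 r0, 0 < r0 &
  forall r, 0 < r -> r < r0 -> forall i, average i r <= t.
Proof.
move=> t0.
have /choice[r0 r0P] i : exists r0, 0 < r0 /\ forall r, 0 < r -> r < r0 -> average i r <= t.
  have [r0 r00 r0P] := f_density i (t * gamma) (mulr_gt0 t0 gamma_gt0).
  exists r0; split=> // r rp rr0; have := r0P r rp rr0.
  rewrite -/(deviation i r) deviation_fin// volumeE// -EFinM lee_fin => avg_le.
  have /andP[lo _] := volume_bounds x r rp.
  rewrite -(ler_pM2r (volume_gt0 x r rp)); apply: le_trans avg_le _.
  by rewrite -mulrA ler_pM2l.
exists (\big[Num.min/1]_i r0 i).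
  by apply/bigmin_gtP; split=> // i _; have [] := r0P i.
move=> r rp rlt i; have [_] := r0P i; apply => //.
by apply: lt_le_trans rlt _; exact: bigmin_le.
Qed.

(** Below [r0] the average is at most [1]; from [r0] on, the volume is at least [gamma * r0^alpha]
    and the affine bound applies. *)
Let average_bounded i : exists2 K : R, 0 <= K & forall r, 0 < r -> average i r <= K.
Proof.
have [r0 r00 r0P] := average_small 1 ltr01; have [C C0 CP] := deviation_le i.
have g0 : 0 < gamma * r0 `^ alpha by rewrite mulr_gt0// powR_gt0.
have CV0 : 0 <= C / (gamma * r0 `^ alpha) by rewrite divr_ge0// ltW.
exists (1 + (C / (gamma * r0 `^ alpha) + C)) => [|r rp]; first by rewrite !addr_ge0.
have [rr0|r0r] := ltP r r0.
  by apply: le_trans (r0P r rp rr0 i) _; rewrite lerDl addr_ge0.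
apply: (@le_trans _ _ (C / (gamma * r0 `^ alpha) + C)); last by rewrite lerDr.
have v0 := volume_gt0 x r rp.
have vr0 : gamma * r0 `^ alpha <= volume x r.
  have /andP[lo _] := volume_bounds x r rp; apply: le_trans lo.
  by rewrite ler_pM2l//; apply: ge0_ler_powR => //; rewrite ?nnegrE; exact: ltW.
have := CP r rp; rewrite deviation_fin// volumeE// -EFinM lee_fin -ler_pdivlMr//.
move=> /le_trans; apply; rewrite mulrDl mulfK ?gt_eqF// lerD2r.
by rewrite ler_wpM2l// lef_pV2.
Qed.

Hypothesis weight_fin : (\sum_(n <oo) (dyadic_weight phi beta n)%:E < +oo)%E.
Variable t : R.
Hypotheses (t_gt0 : 0 < t) (phi_t_gt0 : 0 < phi t).

Lemma hyper_average_vanishing (e : R) : 0 < e ->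
  exists2 eps0, 0 < eps0 & forall eps, 0 < eps -> eps < eps0 ->
    (\int[power_measure mu k]_y (hyper_kernel d mu phi eps x y *
       `|\prod_(j < k) f j (tnth y j) - \prod_(j < k) f j x|%:E) <= e%:E)%E.
Proof.
move=> e0; have [m mE] := power_measure_sigma_finite mu k.
have Gamma_ge0 : 0 <= Gamma.
  have /andP[lo hi] := volume_bounds x 1 ltr01; move: (le_trans lo hi).
  by rewrite powR1 !mulr1; apply: le_trans; exact: ltW.
pose c i := f i x.
pose A r := Gamma ^+ k * (\prod_(i < k) (average i r + `|c i|) - \prod_(i < k) `|c i|).
have A_ge0 r : 0 < r -> 0 <= A r.
  move=> r0; rewrite mulr_ge0 ?exprn_ge0// subr_ge0 ler_prod// => i _.
  by rewrite normr_ge0/= lerDr average_ge0.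
have /choice[K KP] i : exists K, forall r, 0 < r -> average i r <= K.
  by have [K _ KP] := average_bounded i; exists K.
have AM r : 0 < r -> 0 <= A r <= Gamma ^+ k * \prod_(i < k) (K i + `|c i|).
  move=> r0; rewrite A_ge0//= ler_wpM2l ?exprn_ge0// lerBlDr.
  rewrite -[leLHS]addr0 lerD ?prodr_ge0//; apply: ler_prod => i _.
  by rewrite addr_ge0 ?average_ge0//= lerD2r KP.
have A_small u : 0 < u -> exists2 r0, 0 < r0 & forall r, 0 < r -> r < r0 -> A r <= u.
  move=> u0; pose L := Gamma ^+ k * \prod_(i < k) (1 + `|c i|).
  have L0 : 0 <= L by rewrite mulr_ge0 ?exprn_ge0// prodr_ge0// => i _; rewrite addr_ge0.
  (* The minimum with [1] meets the condition of [prod_add_subr_le]; dividing by [L + 1] is safe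
     even if [L = 0] and keeps [v * L <= u]. *)
  pose v := Num.min 1 (u / (L + 1)).
  have L10 : 0 < L + 1 by rewrite ltr_wpDl.
  have v0 : 0 < v by rewrite lt_min ltr01 divr_gt0.
  have [r0 r00 r0P] := average_small v v0; exists r0 => // r rp rr0.
  have v1 : v <= 1 by rewrite ge_min lexx.
  apply: (@le_trans _ _ (v * L)).
    rewrite /A /L mulrCA ler_wpM2l ?exprn_ge0//.
    apply: le_trans (prod_add_subr_le _ _ _ (fun i => `|c i|) v _ _ _) => //; last exact: ltW.
    rewrite lerD2r; apply: ler_prod => i _.
    by rewrite addr_ge0 ?average_ge0//= lerD2r r0P.
  apply: (@le_trans _ _ (u / (L + 1) * L)); first by rewrite ler_wpM2r// ge_min lexx orbT.
  by rewrite mulrAC ler_pdivrMr// ler_pM2l// lerDl.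
pose D := phi t * gamma ^+ k * t `^ beta.
have D0 : 0 < D by rewrite !mulr_gt0 ?exprn_gt0 ?powR_gt0.
have kb0 : 0 < (2 * kappa) `^ beta by rewrite powR_gt0// mulr_gt0.
(* The mass is at least [D * eps^beta] and the series carries the factor [(2 * kappa * eps)^beta];
   this target for the series makes the final bound exactly [e]. *)
have e'0 : 0 < e * D / (2 * kappa) `^ beta by rewrite divr_gt0// mulr_gt0.
have w0 n := dyadic_weight_ge0 phi beta n phi_ge0.
have [s0 s00 s0P] := nneseries_dyadic_small _ A _ w0 weight_fin AM A_small _ e'0.
have k20 : 0 < 2 * kappa by rewrite mulr_gt0.
exists (s0 / (2 * kappa)) => [|eps eps0]; first exact: divr_gt0.
rewrite ltr_pdivlMr// mulrC => /(s0P _ (mulr_gt0 k20 eps0)) series_le.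
pose Q := (D * eps `^ beta)^-1.
have eb0 : 0 < eps `^ beta by rewrite powR_gt0.
have Q0 : 0 <= Q by rewrite invr_ge0 mulr_ge0// ltW.
pose F (y : k.-tuple X) := `|\prod_(j < k) f j (tnth y j) - \prod_(j < k) f j x|.
have F0 y : 0 <= F y by exact: normr_ge0.
have mF : measurable_fun [set: k.-tuple X] F.
  apply: measurableT_comp => //; apply: measurable_funB => //.
  exact: measurable_prod_tnth.
apply: (@le_trans _ _ (\int[power_measure mu k]_y
    ((hyper_profile d phi eps x y)%:E * (Q * F y)%:E))%E).
  have prof0 (y : k.-tuple X) : (0 <= (hyper_profile d phi eps x y)%:E)%E.
    by rewrite lee_fin phi_ge0//; apply: divr_ge0 (ltW eps0); exact: (hypermetric_ge0 d d_ge0).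
  have mass0 : (0 <= hyper_mass d mu k phi eps x)%E.
    by rewrite /hyper_mass mE; exact: integral_ge0.
  rewrite mE; apply: le_integral_nonmeasurable => y _; rewrite /hyper_kernel.
    by rewrite !mule_ge0// inve_ge0.
  rewrite -/(F y) EFinM muleCA muleA lee_wpmul2r ?lee_fin ?normr_ge0//.
  rewrite lee_wpmul2r//.
  have := inve_hyper_mass_le x t eps t_gt0 phi_t_gt0 eps0.
  by rewrite (powRM _ (ltW t_gt0) (ltW eps0)) /Q /D !mulrA.
apply: le_trans (integral_profile_le x eps (fun y => Q * F y) (fun r => Q * A r) _ _ _ _ _) _.
- by [].
- exact: measurable_funM.
- by move=> y; exact: mulr_ge0 Q0 (normr_ge0 _).
- by move=> r r0; rewrite mulr_ge0// A_ge0.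
- move=> r r0; rewrite mE; under eq_integral do rewrite EFinM.
  have mcube : measurable (qcube d x r : set (k.-tuple X)).
    by apply: measurable_qcube; exact: ball_measurable.
  rewrite ge0_integralZl_EFin//; last 2 first.
    by move=> y _; rewrite lee_fin.
    by apply/measurable_EFinP; exact: measurable_funTS.
  rewrite -mulrA EFinM; apply: lee_wpmul2l; first by rewrite lee_fin.
  have := integral_qcube_prodB_le f c (average ^~ r) x r r0 mf.
  by rewrite mE; apply => i; rewrite -deviation_fin.
under eq_eseriesr do rewrite mulrCA EFinM.
rewrite nneseriesZl; last first.
  move=> n _; rewrite lee_fin mulr_ge0// A_ge0// mulr_gt0 ?exprn_gt0// mulr_gt0//.
apply: le_trans (_ : _ <= ((2 * kappa * eps) `^ beta)%:E *
    (Q%:E * (e * D / (2 * kappa) `^ beta)%:E))%E _.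
  by rewrite lee_wpmul2l ?lee_fin ?powR_ge0// lee_wpmul2l// lee_fin.
rewrite -!EFinM lee_fin (powRM _ (ltW k20) (ltW eps0)) /Q.
rewrite le_eqVlt; apply/orP; left; apply/eqP; field.
by rewrite !gt_eqF.
Qed.

End differentiation_point.

End hyper_estimates.

(** * Almost everywhere convergence of the averaged deviations *)

Theorem theorem4p1 (R : realType) (disp : measure_display)
    (X : measurableType disp) (d : X -> X -> R)
    (mu : {measure set X -> \bar R}) (alpha : R) (k : nat) (phi : R -> R)
    (p : 'I_k -> \bar R) (f : 'I_k -> X -> R)
    (alpha_gt0 : 0 < alpha)
    (d_quasi_metric : quasi_metric d)
    (balls_measurable : forall x r, 0 < r -> measurable (qball d x r))
    (mu_regular : borel_regular mu d)
    (X_complete : qcomplete d)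
    (X_ahlfors : ahlfors_regular mu d alpha)
    (balls_open : forall x r, 0 < r -> qopen d (qball d x r))
    (k_ge1 : (1 <= k)%N)
    (phi_ge0 : forall t, 0 <= t -> 0 <= phi t)
    (phi_nonincreasing : forall s t, 0 <= s -> s <= t -> phi t <= phi s)
    (s_phi : (0 < \int[lebesgue_measure]_(t in `]0%R, +oo[)
                    (phi t * t `^ (k%:R * alpha - 1))%:E < +oo)%E)
    (p_gt1 : forall j, (1 < p j)%E)
    (p_sum : (\sum_(j < k) (p j)^-1 = 1)%E)
    (f_Lp : forall j, f j \in Lfun mu (p j)) :
  {ae mu, forall x : X,
    (\int[power_measure mu k]_y
       (hyper_kernel d mu phi eps x y *
        `|\prod_(j < k) f j (tnth y j) - \prod_(j < k) f j x|%:E))%E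
      @[eps --> 0^'+] --> (0 : \bar R)%E}.
Proof.
have [d_ge0 d_sym d_eq0 [kappa kappa_ge1 d_tri]] := d_quasi_metric.
have [gamma [Gamma [gamma_gt0 _ mu_ball]]] := X_ahlfors.
have d_refl x : d x x = 0 by apply/d_eq0.
have mu_sf : sigma_finite setT mu.
  exists (fun n => qball d point n.+1%:R).
    apply/seteqP; split=> // x _; exists (Num.bound (d point x)) => //.
    by rewrite /qball/=; apply: lt_trans (archi_boundP _) _; rewrite ?ltr_nat.
  move=> n; split; first exact: balls_measurable.
  by have /andP[_ /le_lt_trans] := mu_ball point n.+1%:R (ltr0Sn _ _); apply; exact: ltry.
(* [mu] is replaced by a copy bundled with sigma-finiteness; [eq_measure] turns equality of set
   functions into equality of measures. *)
have [nu /eq_measure nuE] := bundle_sigma_finite mu_sf.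
subst mu.
have f_bound j := Lfun_integral_bound nu (p j) (f j) (p_gt1 j) (f_Lp j).
have mf j : measurable_fun [set: X] (f j) by have [] := f_bound j.
have {}f_bound j : exists2 C : R, 0 <= C & forall A, measurable A ->
    (\int[nu]_(y in A) `|f j y|%:E <= C%:E * (1 + nu A))%E.
  by have [] := f_bound j.
have f_density : {ae nu, forall x, forall j, vanishing_density d alpha
    (fun A => \int[nu]_(y in A) `|f j y - f j x|%:E)%E x}.
  apply: filter_forall => j.
  apply: (lebesgue_differentiation d nu kappa alpha gamma Gamma) => // x r r0.
  have [C C0 CP] := f_bound j.
  apply: le_lt_trans (CP _ (balls_measurable x r r0)) _.
  rewrite lte_mul_pinfty// lte_add_pinfty ?ltry//.
  by have /andP[_ /le_lt_trans] := mu_ball x r r0; apply; exact: ltry.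
have beta_gt0 : 0 < k%:R * alpha by rewrite mulr_gt0// ltr0n.
have /andP[s_gt0 s_fin] := s_phi.
(* If [phi] vanished at every positive argument, [s(phi)] would be [0]. One positive value suffices
   to bound the mass from below. *)
have [t t_gt0 phi_t] : exists2 t, 0 < t & 0 < phi t.
  apply: contrapT => phi_le0; move: s_gt0; rewrite integral0_eq ?ltxx// => t.
  rewrite /= in_itv/= andbT => t0; have [->|pt] := eqVneq (phi t) 0; first by rewrite mul0r.
  by exfalso; apply: phi_le0; exists t => //; rewrite lt_def pt phi_ge0// ltW.
have weight_fin := summable_dyadic_weight phi (k%:R * alpha) phi_ge0
  phi_nonincreasing s_fin beta_gt0.
apply: filterS f_density => x x_density.
have small := @hyper_average_vanishing R disp X d nu kappa alpha gamma Gamma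
  d_ge0 d_sym d_refl kappa_ge1 d_tri alpha_gt0 gamma_gt0 mu_ball balls_measurable
  k phi phi_ge0 phi_nonincreasing f x mf f_bound x_density weight_fin t t_gt0 phi_t.
set I := fun eps => _.
have I_ge0 eps : 0 < eps -> (0 <= I eps)%E.
  move=> eps0; rewrite /I; have [m mE] := power_measure_sigma_finite nu k.
  rewrite mE; apply: integral_ge0 => y _; rewrite /hyper_kernel.
  rewrite !mule_ge0 ?lee_fin ?normr_ge0//.
    by rewrite inve_ge0 /hyper_mass mE; apply: integral_ge0 => z _; rewrite lee_fin
      phi_ge0// divr_ge0 ?hypermetric_ge0 ?ltW.
  by rewrite phi_ge0// divr_ge0 ?hypermetric_ge0 ?ltW.
have I_small e : 0 < e -> \forall eps \near 0^'+, (0 <= I eps <= e%:E)%E.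
  move=> e0; have [eps0 eps00 eps0P] := small e e0.
  near=> eps; have eps_gt0 : 0 < eps by [].
  by rewrite I_ge0//= eps0P.
(* Convergence in the extended reals amounts to eventual finiteness together with convergence of the
   finite parts. *)
apply/fine_cvgP; split.
  near=> eps; have /andP[I0 I1] : (0 <= I eps <= 1)%E by near: eps; exact: I_small.
  by rewrite ge0_fin_numE// (le_lt_trans I1)// ltry.
apply/cvgrPdist_le => e e0; near=> eps.
have /andP[I0 Ie] : (0 <= I eps <= e%:E)%E by near: eps; exact: I_small.
rewrite sub0r normrN ger0_norm ?fine_ge0// -lee_fin fineK// ge0_fin_numE//.
by rewrite (le_lt_trans Ie)// ltry.
Unshelve. all: by end_near. Qed.
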